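(* Let $n\ge 6$ be an integer, and call an $n$-vertex graph extremal for $P^2_6$ if it contains no subgraph isomorphic to $P^2_6$ and has exactly $\mathrm{ex}(n,P^2_6)$ edges. Up to isomorphism, the extremal graphs for $P^2_6$ are exactly the following: if $n\equiv 1\pmod 6$: the graphs $F^{\lceil n/2\rceil,j}_n$ and $H^{\lfloor n/2\rfloor}_n$; if $n\equiv 2\pmod 6$: the graphs $F^{n/2,j}_n$ and $F^{n/2+1,j}_n$; if $n\equiv 3\pmod 6$: the graphs $F^{\lceil n/2\rceil,j}_n$ and $H^{\lceil n/2\rceil+1}_n$; if $n\equiv 0\pmod 6$: $H^{n/2}_n$; if $n\equiv 4\pmod 6$: $H^{n/2+1}_n$; if $n\equiv 5\pmod 6$: $H^{\lceil n/2\rceil}_n$. Here, in each $F^{i,j}_n$, $j$ ranges over all integers with $1\le j\le i$ and $3\mid (i-j)$.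
   Context: All graphs are finite, simple and undirected. $P^2_k$ is the square of the path on $k$ vertices $v_1,\dots,v_k$: $v_i,v_j$ adjacent iff $1\le |i-j|\le 2$. $\mathrm{ex}(n,H)$ is the maximum number of edges in an $n$-vertex graph not containing $H$ as a subgraph. For $1\le i\le n-1$ consider $K_{i,n-i}$ with classes $X$, $|X|=i$, and $Y$, $|Y|=n-i$. For $1\le j\le i$ with $3\mid(i-j)$, $F^{i,j}_n$ is obtained by adding inside $X$ a vertex-disjoint union of $(i-j)/3$ triangles and one star on the remaining $j$ vertices of $X$ (a center joined to the other $j-1$ vertices; for $j=1$ this is a single vertex and nothing is added). For $3\mid i$, $H^i_n$ is obtained by adding inside $X$ a vertex-disjoint union of $i/3$ triangles covering $X$. No edges are added inside $Y$. *)

(* Defs.v *)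
From mathcomp Require Import all_boot.

Set Implicit Arguments.
Unset Strict Implicit.
Unset Printing Implicit Defensive.

(* Graphs are adjacency relations on a finite vertex type. *)
Definition simple_graph (T : finType) (e : rel T) : bool :=
  [forall x, ~~ e x x] && [forall x, forall y, e x y == e y x].

Definition edges (T : finType) (e : rel T) : {set {set T}} :=
  [set A | [exists x, exists y, e x y && (A == [set x; y])]].

(* Subgraph containment: the subgraph need not be induced. *)
Definition contains (S T : finType) (h : rel S) (e : rel T) : bool :=
  [exists f : {ffun S -> T},
     injectiveb f && [forall x, forall y, h x y ==> e (f x) (f y)]].

Definition isomorphic (S T : finType) (e : rel S) (e' : rel T) : Prop :=
  exists2 f : S -> T, bijective f & forall x y, e' (f x) (f y) = e x y.

(* Relations on 'I_n are enumerated through their characteristic functions. *)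
Definition ex (n : nat) (S : finType) (h : rel S) : nat :=
  \max_(g : {ffun 'I_n * 'I_n -> bool} |
          simple_graph [rel x y | g (x, y)] &&
          ~~ contains h [rel x y | g (x, y)])
     #|edges [rel x y | g (x, y)]|.

Definition extremal (n : nat) (S : finType) (h : rel S)
    (T : finType) (e : rel T) : Prop :=
  [/\ #|T| = n, simple_graph e, ~~ contains h e & #|edges e| = ex n h].

Definition path_square (k : nat) : rel 'I_k :=
  [rel u v : 'I_k | (u < v <= u + 2) || (v < u <= v + 2)].

(* In the graphs on 'I_n below, X = {0, ..., i-1} and Y = {i, ..., n-1}. *)
Definition complete_bipartite (n i : nat) : rel 'I_n :=
  [rel u v : 'I_n | (u < i) != (v < i)].

(* The triangles {0,1,2}, {3,4,5}, ... covering {0, ..., m-1}, for 3 %| m. *)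
Definition triangles (n m : nat) : rel 'I_n :=
  [rel u v : 'I_n | [&& u < m, v < m, u != v & u %/ 3 == v %/ 3]].

(* The star with center c on the vertices c, ..., i-1. *)
Definition star (n c i : nat) : rel 'I_n :=
  [rel u v : 'I_n | (u == c :> nat) && (c < v < i)
                 || (v == c :> nat) && (c < u < i)].

(* F^{i,j}_n, meaningful for 1 <= j <= i < n and 3 %| i - j. *)
Definition F_graph (n i j : nat) : rel 'I_n :=
  [rel u v : 'I_n | [|| complete_bipartite i u v,
                        triangles (i - j) u v | star (i - j) i u v]].

(* H^i_n, meaningful for 3 %| i and 1 <= i < n. *)
Definition H_graph (n i : nat) : rel 'I_n :=
  [rel u v : 'I_n | complete_bipartite i u v || triangles i u v].

Definition is_F (n i : nat) (T : finType) (e : rel T) : Prop :=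
  exists2 j : nat, [&& 1 <= j, j <= i & 3 %| i - j]
                 & isomorphic e (@F_graph n i j).

Definition is_H (n i : nat) (T : finType) (e : rel T) : Prop :=
  isomorphic e (@H_graph n i).

(* Main.v *)
Require Import Defs.
From mathcomp Require Import all_boot.
From mathcomp Require Import zify.

(**
Let turan n be the claimed value of ex(n, P^2_6). By induction on the number n
of vertices, a P^2_6-free graph other than K_5 has at most turan n edges, and if
it has exactly turan n edges then its vertex set splits into an independent set
Y and a set X spanning no path on four vertices. The induction removes one of:
- a K_5: every other vertex sends at most one edge to it;
- a join of K_3 and three independent vertices: every other vertex sends at
  most three edges to it, and exactly three only towards one of its two sides;
- a K_4: the vertices sending at least two edges to it are independent, and at
  most one vertex sends three;
- in a K_4-free graph, an edge lying in at most one triangle; such an edge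
  exists, since otherwise triangles can be glued into a P^2_6.
In a graph without a path on four vertices the components are triangles and
stars, so a split (X, Y) with |X| = i carries at most i(n - i) + i - s edges, s
being the number of stars. Maximizing over i with s = 0 (forcing 3 | i) or s = 1
gives the list of extremal graphs.
*)

Set Implicit Arguments.
Unset Strict Implicit.
Unset Printing Implicit Defensive.

Definition turan_defect (n : nat) : nat := nth 0 [:: 1; 4; 5; 4; 1; 0] (n %% 6).

Definition turan (n : nat) : nat := (n.+1 ^ 2 - turan_defect n) %/ 4.

Lemma turanE n : 4 * turan n + turan_defect n = n.+1 ^ 2.
Proof.
rewrite /turan /turan_defect; have := ltn_pmod n (isT : 0 < 6).
move: (divn_eq n 6); set k := n %/ 6; move: (n %% 6) => r -> hr.
suff [q hq] : exists q, (k * 6 + r).+1 ^ 2 = 4 * q + nth 0 [:: 1; 4; 5; 4; 1; 0] r.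
  by rewrite hq addnK mulKn.
case: r hr => [|[|[|[|[|[|//]]]]]] _ /=.
- by exists (9 * k ^ 2 + 3 * k); nia.
- by exists (9 * k ^ 2 + 6 * k); nia.
- by exists (9 * k ^ 2 + 9 * k + 1); nia.
- by exists (9 * k ^ 2 + 12 * k + 3); nia.
- by exists (9 * k ^ 2 + 15 * k + 6); nia.
- by exists (9 * k ^ 2 + 18 * k + 9); nia.
Qed.

Lemma turan_defect_le5 n : turan_defect n <= 5.
Proof.
rewrite /turan_defect; have := ltn_pmod n (isT : 0 < 6).
by case: (n %% 6) => [|[|[|[|[|[|]]]]]].
Qed.

(* [(n + 1) ^ 2 - (4 + ~~ odd n)] is four times the bound for K_4-free graphs. *)
Lemma turan_defect_odd n : turan_defect n <= 5 - odd n.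
Proof.
rewrite /turan_defect [in odd n](divn_eq n 6) oddD oddM andbF.
have := ltn_pmod n (isT : 0 < 6).
by case: (n %% 6) => [|[|[|[|[|[|]]]]]].
Qed.

Lemma turanD6 n : turan (n + 6) = turan n + 3 * n + 12.
Proof.
have := turanE (n + 6); have := turanE n.
by rewrite /turan_defect modnDr; nia.
Qed.

Section Arcs.

Variables (T : finType) (e : rel T).
Hypotheses (eC : symmetric e) (eI : irreflexive e).
Implicit Types (A B K S X : {set T}) (s : seq T).

Definition degree_in (x : T) A : nat := \sum_(y in A) e x y.

(* Edges are counted as ordered pairs: [arc_count S S] is twice the number of edges in [S]. *)
Definition arc_count A B : nat := \sum_(x in A) degree_in x B.

Lemma adj_neq x y : e x y -> x != y.
Proof. by move=> exy; apply: contraTneq exy => ->; rewrite eI. Qed.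

Lemma arcsC A B : arc_count A B = arc_count B A.
Proof.
rewrite /arc_count /degree_in exchange_big /=.
by apply: eq_bigr => x _; apply: eq_bigr => y _; rewrite eC.
Qed.

Lemma deg_in_split x K S : K \subset S ->
  degree_in x S = degree_in x K + degree_in x (S :\: K).
Proof.
move=> sKS; rewrite /degree_in (big_setID K) /=.
by rewrite (setIidPr sKS).
Qed.

Lemma arcs_split K S : K \subset S ->
  arc_count S S = arc_count K K + 2 * arc_count (S :\: K) K + arc_count (S :\: K) (S :\: K).
Proof.
move=> sKS; rewrite mul2n -addnn {1}/arc_count (big_setID K) /= (setIidPr sKS).
have spl A : \sum_(x in A) degree_in x S = arc_count A K + arc_count A (S :\: K).
  by rewrite -big_split; apply: eq_bigr => x _; rewrite (deg_in_split _ sKS).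
rewrite !spl [arc_count K (S :\: K)]arcsC; lia.
Qed.

Lemma deg_in_le x A : degree_in x A <= #|A|.
Proof. by rewrite -sum1_card leq_sum // => y _; case: (e x y). Qed.

Lemma arcs_le_const A B k :
  (forall x, x \in A -> degree_in x B <= k) -> arc_count A B <= k * #|A|.
Proof.
by move=> h; rewrite mulnC -sum_nat_const; apply: leq_sum => x; apply: h.
Qed.

Lemma arcs_le A B : arc_count A B <= #|A| * #|B|.
Proof. by rewrite mulnC; apply: arcs_le_const => x _; apply: deg_in_le. Qed.

Lemma arcs_diag_le A : arc_count A A <= #|A| * #|A|.-1.
Proof.
rewrite mulnC; apply: arcs_le_const => x xA.
rewrite /degree_in (bigD1 x) //= eI add0n.
rewrite -(leq_add2r 1) addn1 addn1 prednK; last by rewrite (cardD1 x) xA.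
rewrite -sum1_card (bigD1 x (F := fun=> 1)) //= add1n ltnS.
by apply: leq_sum => y _; case: (e x y).
Qed.

Lemma deg_in_seq x s : uniq s ->
  degree_in x [set y in s] = \sum_(y <- s) (e x y : nat).
Proof.
move=> us; rewrite big_uniq //=.
by apply: eq_bigl => y; rewrite inE.
Qed.

Lemma card_set_seq s : uniq s -> #|[set y in s]| = size s.
Proof. by move=> us; rewrite cardsE; apply/card_uniqP. Qed.

Lemma card_setD_seq s S : uniq s -> all [in S] s -> #|S :\: [set y in s]| = #|S| - size s.
Proof.
move=> us /allP sS; rewrite -(card_set_seq us) cardsD; congr (_ - #|pred_of_set _|).
by apply/setIidPr/subsetP => x; rewrite inE => /sS.
Qed.

Lemma sum_eq_bound A (F G : T -> nat) :
  (forall x, x \in A -> F x <= G x) ->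
  \sum_(x in A) G x <= \sum_(x in A) F x ->
  forall x, x \in A -> F x = G x.
Proof.
move=> FG GF x xA; have sFG : \sum_(y in A) F y <= \sum_(y in A) G y by apply: leq_sum.
have [_] := @leqif_sum T (fun i => i \in A) (fun i => F i == G i) F G
  (fun i hi => conj (FG i hi) erefl).
rewrite eqn_leq sFG GF => /esym /forall_inP h; exact/eqP/h.
Qed.

Definition has_clique k S : bool :=
  [exists t : k.-tuple T, all [in S] t && pairwise e t].

Lemma has_cliqueP k S :
  reflect (exists s, [/\ size s = k, all [in S] s & pairwise e s])
          (has_clique k S).
Proof.
apply: (iffP existsP) => [[t /andP[tS te]]|[s [sk sS se]]].
  by exists t; rewrite size_tuple.
by move/eqP: sk => sk; exists (Tuple sk); apply/andP.
Qed.

Lemma pairwise_uniq_adj s : pairwise e s -> uniq s.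
Proof.
move=> es; rewrite uniq_pairwise; apply: sub_pairwise es.
exact: adj_neq.
Qed.

(* Adjacent vertices are distinct anyway, so only the six pairs at distance at least 3 are listed. *)
Definition p6_free : Prop := forall a b c d x y,
  a != d -> a != x -> a != y -> b != x -> b != y -> c != y ->
  e a b -> e a c -> e b c -> e b d -> e c d -> e c x -> e d x -> e d y ->
  e x y -> False.

Definition p4_free X : Prop := forall p q r t,
  p \in X -> q \in X -> r \in X -> t \in X ->
  p != r -> p != t -> q != t -> e p q -> e q r -> e r t -> False.

Definition structured S : Prop := exists X,
  [/\ X \subset S, p4_free X &
      forall y z, y \in S :\: X -> z \in S :\: X -> e y z = false].

End Arcs.

(* [lia] splits on boolean atoms, so adjacency facts are cleared first. *)
Ltac nlia :=
  repeat match goal with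
  | H : is_true (uniq _) |- _ => clear H
  | H : is_true (all _ _) |- _ => clear H
  | H : is_true (pairwise _ _) |- _ => clear H
  | H : is_true (~~ _) |- _ => clear H
  | H : is_true (_ \in _) |- _ => clear H
  | H : is_true (_ \subset _) |- _ => clear H
  | H : _ = false |- _ => clear H
  | H : is_true (?r _ _) |- _ => is_var r; clear H
  end; lia.

Ltac adj :=
  solve [ assumption
  | match goal with C : symmetric ?e |- is_true (?e _ _) =>
      rewrite C; assumption end
  | match goal with |- is_true (_ != _) =>
      rewrite eq_sym; assumption end
  | match goal with I : irreflexive ?e |- is_true (_ != _) =>
      apply: (adj_neq I); assumption end
  | match goal with I : irreflexive ?e |- is_true (_ != _) =>
      rewrite eq_sym; apply: (adj_neq I); assumption end ].

Section Removal.

Variables (T : finType) (e : rel T).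
Hypotheses (eC : symmetric e) (eI : irreflexive e) (P6 : p6_free e).
Implicit Types (A B K S X : {set T}) (s : seq T).

Notation arcs := (arc_count e).
Notation deg_in := (degree_in e).

Lemma k5_two_nbrs a b c d x v :
  e a b -> e a c -> e a d -> e a x -> e b c -> e b d -> e b x ->
  e c d -> e c x -> e d x -> v != c -> v != d -> v != x ->
  e v a && e v b = false.
Proof.
move=> *; apply/negP => /andP[? ?].
by apply: (P6 (a := v) (b := a) (c := b) (d := c) (x := d) (y := x)); adj.
Qed.

Lemma k5_deg_in s v : size s = 5 -> pairwise e s -> v \notin s ->
  deg_in v [set y in s] <= 1.
Proof.
move=> ss es; have us := pairwise_uniq_adj eI es.
rewrite deg_in_seq //; move: s ss es {us}.
case=> [|a[|b[|c[|d[|x[|//]]]]]] //= _; rewrite !andbT !big_cons big_nil !inE.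
case/and4P=> /and4P[? ? ? ?] /and3P[? ? ?] /andP[? ?] ?.
rewrite !negb_or => /and5P[? ? ? ? ?].
have Hab : e v a && e v b = false by apply: (@k5_two_nbrs a b c d x); adj.
have Hac : e v a && e v c = false by apply: (@k5_two_nbrs a c b d x); adj.
have Had : e v a && e v d = false by apply: (@k5_two_nbrs a d b c x); adj.
have Hax : e v a && e v x = false by apply: (@k5_two_nbrs a x b c d); adj.
have Hbc : e v b && e v c = false by apply: (@k5_two_nbrs b c a d x); adj.
have Hbd : e v b && e v d = false by apply: (@k5_two_nbrs b d a c x); adj.
have Hbx : e v b && e v x = false by apply: (@k5_two_nbrs b x a c d); adj.
have Hcd : e v c && e v d = false by apply: (@k5_two_nbrs c d a b x); adj.
have Hcx : e v c && e v x = false by apply: (@k5_two_nbrs c x a b d); adj.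
have Hdx : e v d && e v x = false by apply: (@k5_two_nbrs d x a b c); adj.
move: Hab Hac Had Hax Hbc Hbd Hbx Hcd Hcx Hdx.
by case: (e v a); case: (e v b); case: (e v c); case: (e v d); case: (e v x).
Qed.

Lemma k5_removal s S : size s = 5 -> pairwise e s -> all [in S] s ->
  arcs S S <= 20 + 2 * (#|S| - 5) + arcs (S :\: [set y in s]) (S :\: [set y in s]).
Proof.
move=> ss es sS; have us := pairwise_uniq_adj eI es.
have sub : [set y in s] \subset S by apply/subsetP => y; rewrite inE; move/allP: sS; exact.
rewrite (arcs_split eC sub) leq_add2r leq_add //.
  by have := arcs_diag_le eI [set y in s]; rewrite card_set_seq // ss.
rewrite leq_mul2l /= -[leqRHS]mul1n -ss -(card_setD_seq us sS).
apply: arcs_le_const => v; rewrite !inE => /andP[vs _].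
exact: k5_deg_in.
Qed.

Lemma triangle_nbr a b c x y v :
  e a b -> e a c -> e b c -> e x a -> e x b -> e x c -> e y a -> e y b -> e y c ->
  x != y -> v != b -> v != c -> v != y -> e v x && e v a = false.
Proof.
move=> *; apply/negP => /andP[? ?].
by apply: (P6 (a := v) (b := x) (c := a) (d := b) (x := y) (y := c)); adj.
Qed.

(* The join of the triangle abc and the three vertices x, y, z. *)
Section Block.

Variables (a b c x y z : T).
Hypotheses (us : uniq [:: a; b; c; x; y; z]).
Hypotheses (ab : e a b) (ac : e a c) (bc : e b c).
Hypotheses (xa : e x a) (xb : e x b) (xc : e x c).
Hypotheses (ya : e y a) (yb : e y b) (yc : e y c).
Hypotheses (za : e z a) (zb : e z b) (zc : e z c).

Let K : {set T} := [set t in [:: a; b; c; x; y; z]].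

Lemma block_deg_in v : v \notin [:: a; b; c; x; y; z] -> deg_in v K <= 3 /\
  (3 <= deg_in v K -> if e v x then e v y && e v z else [&& e v a, e v b & e v c]).
Proof.
rewrite deg_in_seq // !big_cons big_nil !inE !negb_or.
case/and5P=> va vb vc vx /andP[vy vz]; move: us.
rewrite /= !inE !negb_or => /and5P[_ _ _ /andP[xy xz] /andP[yz _]].
have Hxa : e v x && e v a = false by apply: (@triangle_nbr a b c x y); adj.
have Hxb : e v x && e v b = false by apply: (@triangle_nbr b a c x y); adj.
have Hxc : e v x && e v c = false by apply: (@triangle_nbr c a b x y); adj.
have Hya : e v y && e v a = false by apply: (@triangle_nbr a b c y x); adj.
have Hyb : e v y && e v b = false by apply: (@triangle_nbr b a c y x); adj.
have Hyc : e v y && e v c = false by apply: (@triangle_nbr c a b y x); adj.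
have Hza : e v z && e v a = false by apply: (@triangle_nbr a b c z x); adj.
have Hzb : e v z && e v b = false by apply: (@triangle_nbr b a c z x); adj.
have Hzc : e v z && e v c = false by apply: (@triangle_nbr c a b z x); adj.
move: Hxa Hxb Hxc Hya Hyb Hyc Hza Hzb Hzc.
by case: (e v x); case: (e v y); case: (e v z); case: (e v a); case: (e v b); case: (e v c).
Qed.

Lemma block_arcs_le : arcs K K <= 24.
Proof.
have := us; rewrite /= !inE !negb_or.
case/and5P=> /and5P[? ? ? ? ?] /and4P[? ? ? ?] /and3P[? ? ?] /andP[? ?] /andP[? _].
have Hxy : e x y = false.
  apply/negP => ?; apply: (P6 (a := z) (b := a) (c := b) (d := c) (x := x) (y := y)); adj.
have Hxz : e x z = false.
  apply/negP => ?; apply: (P6 (a := y) (b := a) (c := b) (d := c) (x := x) (y := z)); adj.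
have Hyz : e y z = false.
  apply/negP => ?; apply: (P6 (a := x) (b := a) (c := b) (d := c) (x := y) (y := z)); adj.
rewrite /arc_count big_mkcond /=.
have -> : \sum_i (if i \in K then deg_in i K else 0) =
   \sum_(i <- [:: a; b; c; x; y; z]) deg_in i K.
  by rewrite [RHS]big_uniq // -big_mkcond; apply: eq_bigl => i; rewrite inE.
have ge3 t : t \in [:: a; b; c] -> deg_in t K <= 5.
  rewrite deg_in_seq // !big_cons big_nil !inE.
  by case/or3P=> /eqP->; rewrite eI; do 5 case: (e _ _).
have ge0 t : t \in [:: x; y; z] -> deg_in t K <= 3.
  rewrite deg_in_seq // !big_cons big_nil !inE.
  case/or3P=> /eqP->; rewrite ?[e y x]eC ?[e z x]eC ?[e z y]eC ?Hxy ?Hxz ?Hyz eI;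
    by do 3 case: (e _ _).
rewrite !big_cons big_nil.
have := ge3 a; have := ge3 b; have := ge3 c.
have := ge0 x; have := ge0 y; have := ge0 z.
rewrite !inE !eqxx !orbT => /(_ isT) ? /(_ isT) ? /(_ isT) ? /(_ isT) ? /(_ isT) ? /(_ isT) ?.
nlia.
Qed.

Lemma block_removal S : all [in S] [:: a; b; c; x; y; z] -> ~~ has_clique e 5 S ->
  arcs (S :\: K) (S :\: K) <= 2 * turan (#|S| - 6) ->
  arcs S S <= 2 * turan #|S| /\ (arcs S S = 2 * turan #|S| -> structured e S).
Proof.
move=> sS nK5 IH.
have sub : K \subset S by apply/subsetP => t; rewrite inE; move/allP: sS; exact.
have cR := card_setD_seq us sS; rewrite -/K /= in cR.
have cS : 6 <= #|S| by have := subset_leq_card sub; rewrite card_set_seq.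
have degR v : v \in S :\: K -> deg_in v K <= 3.
  by rewrite !inE => /andP[+ _] => vK; have [] := @block_deg_in v; rewrite ?inE.
have bRK : arcs (S :\: K) K <= 3 * (#|S| - 6) by rewrite -cR; apply: arcs_le_const.
have := turanD6 (#|S| - 6); rewrite subnK // => tE.
have bK := block_arcs_le; have eS := arcs_split eC sub.
split=> [|eqS]; first by nlia.
have eqRK : 3 * #|S :\: K| <= arcs (S :\: K) K by rewrite cR; nlia.
have deg3 v : v \in S :\: K -> deg_in v K = 3.
  apply: (sum_eq_bound degR).
  by rewrite sum_nat_const mulnC.
have := us; rewrite /= !inE !negb_or.
case/and5P=> /and5P[? ? ? ? ?] /and4P[? ? ? ?] /and3P[? ? ?] /andP[? ?] /andP[? _].
have Hxy : e y x = false.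
  apply/negP => ?; apply: (P6 (a := z) (b := a) (c := b) (d := c) (x := x) (y := y)); adj.
have Hxz : e z x = false.
  apply/negP => ?; apply: (P6 (a := y) (b := a) (c := b) (d := c) (x := x) (y := z)); adj.
have Xy v : v \in S -> e v x -> e v y.
  move=> vS vx; have [vK|vK] := boolP (v \in K).
    move: vK vx; rewrite !inE.
    by do 5?[case/orP]; move/eqP->; rewrite ?eI ?Hxy ?Hxz // => _; adj.
  have [|_] := @block_deg_in v; first by move: vK; rewrite inE.
  rewrite deg3; last by rewrite in_setD vK vS.
  by rewrite vx => /(_ isT) /andP[].
have Yabc v : v \in S -> ~~ e v x -> [&& e v a, e v b & e v c].
  move=> vS vx; have [vK|vK] := boolP (v \in K).
    move: vK vx; rewrite !inE.
    by do 5?[case/orP]; move/eqP-> => nx; apply/and3P; split; try adj;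
      case/negP: nx; adj.
  have [|_] := @block_deg_in v; first by move: vK; rewrite inE.
  rewrite deg3; last by rewrite in_setD vK vS.
  by rewrite (negPf vx) => /(_ isT).
exists [set v in S | e v x]; split.
- by apply/subsetP => v; rewrite inE => /andP[].
- move=> p q r t; rewrite !inE => /andP[pS px] /andP[qS qx] /andP[rS rx] /andP[tS tx].
  have py := Xy p pS px; have qy := Xy q qS qx.
  have ry := Xy r rS rx; have ty := Xy t tS tx.
  move=> *; apply: (P6 (a := x) (b := p) (c := q) (d := y) (x := r) (y := t)); adj.
- move=> u v; rewrite !inE => /andP[+ uS] /andP[+ vS]; rewrite uS vS /= => nux nvx.
  have /and3P[? ? ?] := Yabc _ uS nux; have /and3P[? ? ?] := Yabc _ vS nvx.
  apply/negP => ?; case/negP: nK5; apply/has_cliqueP; exists [:: a; b; c; u; v].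
  split=> //=; last by repeat (apply/andP; split=> //); adj.
  by move: sS; rewrite /= uS vS => /and5P[-> -> -> _ _].
Qed.

End Block.
End Removal.

Ltac perm4 :=
  apply/permP => ? /=;
  repeat (match goal with |- context [nat_of_bool ?b] =>
            move: (nat_of_bool b) => ? end);
  clear; lia.

(* [p] and [q] count the vertices sending at least two, respectively at most one, edges to a K_4. *)
Lemma k4_count p q a aR f f' d d' :
  4 * f + d = (p + q + 4).+1 ^ 2 -> 4 * f' + d' = (p + q).+1 ^ 2 ->
  d <= 5 -> d' <= 5 -> (p + q = 2 -> f = 12) -> 2 <= p + q ->
  a <= 14 + 4 * p + 2 * q + aR -> aR <= 2 * f' -> aR <= 2 * (q * p) + q * q.-1 ->
  a < 2 * f.
Proof.
move=> fE f'E d5 d'5 f6 n2 ha h1 h2.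
have [pq2|pq2] := eqVneq (p + q) 2.
  have f12 := f6 pq2; rewrite {f6 fE f'E}f12; move: pq2 ha h1 h2.
  by case: q n2 => [|[|[|q]]] _; lia.
case: q fE f'E f6 n2 ha h1 h2 pq2 => [|[|[|q]]] fE f'E _ n2 ha h1 h2 pq2; [nia | nia | nia | ].
move: fE f'E; set m := p + q.+3 => fE f'E.
have : (m + 4).+1 ^ 2 = m.+1 ^ 2 + 8 * m + 24 by clear; nia.
rewrite -fE -f'E /m; lia.
Qed.

Section K4.

Variables (T : finType) (e : rel T).
Hypotheses (eC : symmetric e) (eI : irreflexive e) (P6 : p6_free e).
Implicit Types (A B K S X : {set T}) (s : seq T).

Notation arcs := (arc_count e).
Notation deg_in := (degree_in e).

Lemma sum_pred_card A (P : pred T) : \sum_(x in A) (P x : nat) = #|[set x in A | P x]|.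
Proof.
rewrite -sum1_card big_mkcond [RHS]big_mkcond; apply: eq_bigr => x _.
by rewrite inE; case: (x \in A); case: (P x).
Qed.

Lemma structured_triple S p q r :
  all [in S] [:: p; q; r] ->
  (forall y z, y \in S -> z \in S -> y \notin [:: p; q; r] ->
     z \notin [:: p; q; r] -> e y z = false) ->
  structured e S.
Proof.
move=> /allP XS Y0; exists [set y in [:: p; q; r]]; split.
- by apply/subsetP => y; rewrite inE; apply: XS.
- move=> a b c d; rewrite !in_set => aX bX cX dX ac ad bd ab bc cd.
  suff /uniq_leq_size : uniq [:: a; b; c; d].
    move=> /(_ [:: p; q; r]) h; suff : 4 <= 3 by [].
    by apply: h; apply/allP; rewrite /= aX bX cX dX.
  by rewrite /= !inE !negb_or ac ad bd !(adj_neq eI).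
- move=> y z; rewrite 2!in_setD !in_set => /andP[yX yS] /andP[zX zS]; exact: Y0.
Qed.

Section Fixed.

Variables (S : {set T}) (s0 : seq T).
Hypotheses (s0S : all [in S] s0) (sz0 : size s0 = 4) (e0 : pairwise e s0).
Hypothesis nK5 : ~~ has_clique e 5 S.
Hypothesis nW : forall a b c x y z, all [in S] [:: a; b; c; x; y; z] ->
  uniq [:: a; b; c; x; y; z] -> pairwise e [:: a; b; c] ->
  all (e x) [:: a; b; c] -> all (e y) [:: a; b; c] -> all (e z) [:: a; b; c] -> False.

Let K : {set T} := [set y in s0].

Lemma k4_reorder p q r t : perm_eq [:: p; q; r; t] s0 ->
  [/\ [/\ p \in S, q \in S, r \in S & t \in S],
      [/\ e p q, e p r & e p t], [/\ e q r, e q t & e r t] &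
      forall v, deg_in v K = e v p + (e v q + (e v r + e v t))].
Proof.
move=> perm; have us0 := pairwise_uniq_adj eI e0.
have us : uniq [:: p; q; r; t] by rewrite (perm_uniq perm).
have /allP in0 := s0S.
have adj0 x y : x \in s0 -> y \in s0 -> x != y -> e x y.
  move=> xs ys; have := e0; move: (s0) xs ys; elim=> //= z s IH.
  rewrite !inE => /orP[/eqP->|xs] /orP[/eqP->|ys] /andP[/allP zs es] xy //.
  - by rewrite eqxx in xy.
  - exact: zs.
  - by rewrite eC zs.
  - exact: IH.
have mem y : y \in [:: p; q; r; t] -> y \in s0 by rewrite (perm_mem perm).
move: us; rewrite /= !inE !negb_or => /and4P[/and3P[pq pr pt] /andP[qr qt] rt _].
have [mp mq mr mt] : [/\ p \in s0, q \in s0, r \in s0 & t \in s0].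
  by split; apply: mem; rewrite !inE eqxx ?orbT.
split; try by split; auto.
move=> v; rewrite /K deg_in_seq // -(perm_big _ perm) /=.
by rewrite !big_cons big_nil addn0.
Qed.

Lemma k4_pick2 u : 2 <= deg_in u K ->
  exists p q r t, [/\ perm_eq [:: p; q; r; t] s0, e u p & e u q].
Proof.
rewrite /K deg_in_seq; last exact: pairwise_uniq_adj e0.
move: s0 sz0; case=> [|a[|b[|c[|d[|//]]]]] //= _; rewrite !big_cons big_nil.
case ha: (e u a).
  case hb: (e u b); first by exists a, b, c, d.
  case hc: (e u c); first by exists a, c, b, d; split=> //; perm4.
  case hd: (e u d); last by [].
  by exists a, d, b, c; split=> //; perm4.
case hb: (e u b).
  case hc: (e u c); first by exists b, c, a, d; split=> //; perm4.
  case hd: (e u d); last by [].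
  by exists b, d, a, c; split=> //; perm4.
case hc: (e u c); case hd: (e u d) => // _.
by exists c, d, a, b; split=> //; perm4.
Qed.

Lemma k4_pick3 u : 3 <= deg_in u K ->
  exists p q r t, [/\ perm_eq [:: p; q; r; t] s0, e u p, e u q & e u r].
Proof.
move=> d3; have [p [q [r [t [perm up uq]]]]] := k4_pick2 (ltnW d3).
have [_ _ _ dE] := k4_reorder perm; move: d3; rewrite dE up uq.
case ur: (e u r); first by exists p, q, r, t.
case ut: (e u t) => // _; exists p, q, t, r; split=> //.
by apply: perm_trans perm; perm4.
Qed.

Lemma outside_neq p q r t v : perm_eq [:: p; q; r; t] s0 -> v \in S :\: K ->
  [/\ v \in S, v != p, v != q, v != r & v != t].
Proof.
move=> perm; rewrite !inE -(perm_mem perm) !inE !negb_or.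
by case/andP=> /and4P[].
Qed.

Lemma k4_deg_le3 v : v \in S :\: K -> deg_in v K <= 3.
Proof.
move=> vR; case: leqP => // d4; have [p [q [r [t [perm vp vq vr]]]]] := k4_pick3 (ltnW d4).
have [[pS qS rS tS] [pq pr pt] [qr qt rt] dE] := k4_reorder perm.
have [vS _ _ _ _] := outside_neq perm vR.
move: d4; rewrite dE vp vq vr; case vt: (e v t) => // _.
case/negP: nK5; apply/has_cliqueP; exists [:: v; p; q; r; t]; split=> //=.
  by rewrite vS pS qS rS tS.
by rewrite vp vq vr vt pq pr pt qr qt rt.
Qed.

Lemma k4_heavy_independent u v : u \in S :\: K -> v \in S :\: K ->
  2 <= deg_in u K -> 2 <= deg_in v K -> e u v = false.
Proof.
move=> uR vR /k4_pick2[p [q [r [t [perm up uq]]]]] d2; apply/negP => uv.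
have [[pS qS rS tS] [pq pr pt] [qr qt rt] dE] := k4_reorder perm.
have [uS ? ? ? ?] := outside_neq perm uR.
have [vS ? ? ? ?] := outside_neq perm vR.
have vp : e v p = false.
  by apply/negP => ?; apply: (P6 (a := v) (b := u) (c := p) (d := q) (x := r) (y := t)); adj.
have vq : e v q = false.
  by apply/negP => ?; apply: (P6 (a := v) (b := u) (c := q) (d := p) (x := r) (y := t)); adj.
move: d2; rewrite dE vp vq; case vr: (e v r); case vt: (e v t) => // _.
by apply: (P6 (a := u) (b := p) (c := q) (d := r) (x := t) (y := v)); adj.
Qed.

Lemma k4_heavy3_unique u v : u \in S :\: K -> v \in S :\: K ->
  3 <= deg_in u K -> 3 <= deg_in v K -> u = v.
Proof.
move=> uR vR /k4_pick3[p [q [r [t [perm up uq ur]]]]] d3.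
have [[pS qS rS tS] [pq pr pt] [qr qt rt] dE] := k4_reorder perm.
have [uS ? ? ? ?] := outside_neq perm uR.
have [vS ? ? ? ?] := outside_neq perm vR.
have [//|uv] := eqVneq u v; exfalso.
move: d3; rewrite dE; case vt: (e v t).
  case vp: (e v p); case vq: (e v q); case vr: (e v r) => // _.
  - by apply: (P6 (a := u) (b := r) (c := p) (d := q) (x := t) (y := v)); adj.
  - by apply: (P6 (a := u) (b := r) (c := p) (d := q) (x := t) (y := v)); adj.
  - by apply: (P6 (a := u) (b := q) (c := p) (d := r) (x := t) (y := v)); adj.
  - by apply: (P6 (a := u) (b := p) (c := q) (d := r) (x := t) (y := v)); adj.
case vp: (e v p); case vq: (e v q); case vr: (e v r) => // _.
apply: (@nW p q r t u v) => //=; rewrite ?pS ?qS ?rS ?tS ?uS ?vS ?pq ?pr ?qr ?up ?uq ?ur //.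
- by rewrite !inE !negb_or; repeat (apply/andP; split=> //); adj.
- by rewrite eC pt eC qt eC rt.
- by rewrite vp vq vr.
Qed.

Lemma k4_removal : arcs (S :\: K) (S :\: K) <= 2 * turan (#|S| - 4) ->
  arcs S S <= 2 * turan #|S| /\ (arcs S S = 2 * turan #|S| -> structured e S).
Proof.
move=> IH; have us0 := pairwise_uniq_adj eI e0.
have sub : K \subset S by apply/subsetP => t; rewrite inE; move/allP: s0S; exact.
have cR := card_setD_seq us0 s0S; rewrite -/K sz0 in cR.
have cS : 4 <= #|S| by have := subset_leq_card sub; rewrite card_set_seq ?sz0.
have bK : arcs K K <= 12 by have := arcs_diag_le eI K; rewrite card_set_seq // sz0.
have eS := arcs_split eC sub.
set R := S :\: K in IH cR eS *.
have s4 : #|S| = 4 -> R = set0 by move=> c4; apply: cards0_eq; lia.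
pose S2 := [set v in R | 2 <= deg_in v K]; pose S3 := [set v in R | 3 <= deg_in v K].
have c3 : #|S3| <= 1.
  apply/card_le1_eqP => u v; rewrite [u \in _]in_set [v \in _]in_set.
  by move=> /andP[uR u3] /andP[vR v3]; apply: k4_heavy3_unique.
have bRK : arcs R K <= #|R| + #|S2| + #|S3|.
  rewrite -sum1_card -!sum_pred_card -!big_split /=; apply: leq_sum => v vR.
  by have := k4_deg_le3 vR; case: (deg_in v K) => [|[|[|[|]]]].
have sub2 : S2 \subset R by apply/subsetP => v; rewrite in_set => /andP[].
have c2 : #|S2| + #|R :\: S2| = #|R|.
  by rewrite cardsD (setIidPr sub2) subnKC // subset_leq_card.
have b22 : arcs S2 S2 = 0.
  apply: big1 => u; rewrite in_set => /andP[uR u2]; apply: big1 => v.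
  by rewrite in_set => /andP[vR v2]; rewrite k4_heavy_independent.
have eR := arcs_split eC sub2; have b12 := arcs_le e (R :\: S2) S2.
have b11 := arcs_diag_le eI (R :\: S2).
have tS := turanE #|S|; have tR := turanE (#|S| - 4).
have dS := turan_defect_le5 #|S|; have dR := turan_defect_le5 (#|S| - 4).
have [n6|n6] := leqP 6 #|S|.
  suff lt : arcs S S < 2 * turan #|S|.
    by split; [exact: ltnW | move=> eq; rewrite eq ltnn in lt].
  have eqS : #|S2| + #|R :\: S2| + 4 = #|S| by rewrite c2 cR subnK.
  apply: (@k4_count #|S2| #|R :\: S2| _ (arcs R R) _ (turan (#|S| - 4)) _ _ _ _ dS dR).
  - by rewrite eqS.
  - by rewrite c2 -cR in tR *.
  - by rewrite c2 cR => n2; rewrite -[#|S|](subnK cS) n2.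
  - by nlia.
  - by nlia.
  - by [].
  - by nlia.
have {}n6 : #|S| = 4 \/ #|S| = 5 by nlia.
have memS v p q r t : perm_eq [:: p; q; r; t] s0 -> v \in S ->
    v \notin [:: p; q; r] -> v = t \/ v \in R.
  move=> perm vS vX.
  have /and3P[vp vq vr] : [&& v != p, v != q & v != r] by move: vX; rewrite !inE !negb_or.
  rewrite /R in_setD vS andbT in_set -(perm_mem perm) !inE.
  rewrite (negPf vp) (negPf vq) (negPf vr) /=.
  by have [->|_] := eqVneq v t; [left | right].
have [c4|c5] := n6.
  have R0 := s4 c4; split.
    have aR A : arcs R A = 0 by rewrite R0; exact: big_set0.
    by move: eS; rewrite !aR c4; have -> : turan 4 = 6 by []; nlia.
  move=> _; move: s0 sz0 memS s0S => [|p [|q [|r [|t [|//]]]]] //= _ memS pS.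
  apply: (@structured_triple _ p q r); first by case/and5P: pS => /= -> -> ->.
  move=> y z yS zS yX zX.
  have [->|] := memS y p q r t (perm_refl _) yS yX; last by rewrite R0 inE.
  have [->|] := memS z p q r t (perm_refl _) zS zX; last by rewrite R0 inE.
  exact: eI.
have /eqP/cards1P[v Rv] : #|R| = 1 by nlia.
have vR : v \in R by rewrite Rv inE.
have d3 := k4_deg_le3 vR.
have aRR : arcs R R = 0 by rewrite Rv /arc_count /degree_in !big_set1 eI.
have aRK : arcs R K = deg_in v K by rewrite Rv /arc_count big_set1.
have -> : 2 * turan #|S| = 18 by rewrite c5.
split; first by nlia.
move=> eqS; have /k4_pick3[p [q [r [t [perm vp vq vr]]]]] : 3 <= deg_in v K by nlia.
have [[pS qS rS _] _ _ dE] := k4_reorder perm.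
have vt : e v t = false.
  by move: d3; rewrite dE vp vq vr; case: (e v t).
apply: (@structured_triple _ p q r); first by rewrite /= pS qS rS.
move=> y z yS zS yX zX.
have tv w : w \in S -> w \notin [:: p; q; r] -> w = t \/ w = v.
  by move=> wS /(memS _ _ _ _ _ perm wS)[->|]; [left | rewrite Rv inE => /eqP; right].
by have [->|->] := tv y yS yX; have [->|->] := tv z zS zX; rewrite ?eI // eC.
Qed.

End Fixed.
End K4.

Section K4Free.

Variables (T : finType) (e : rel T).
Hypotheses (eC : symmetric e) (eI : irreflexive e) (P6 : p6_free e).
Implicit Types (A B K S X : {set T}) (s : seq T).

Notation arcs := (arc_count e).
Notation deg_in := (degree_in e).

(* A universal vertex [c] and a complete bipartite rest; both sides nonempty once [S] has three elements. *)
Definition wheel S : Prop := exists c A,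
  [/\ c \in S,
      forall x, x \in S -> x != c -> e c x,
      forall x y, x \in S -> y \in S -> x != c -> y != c ->
        e x y = ((x \in A) != (y \in A)) &
      2 < #|S| -> exists a b, [/\ a \in S, b \in S, a != c, b != c & (a \in A) && (b \notin A)]].

Lemma wheel_structured S : wheel S -> structured e S.
Proof.
move=> [c [A [cS cadj col _]]].
exists [set x in S | (x == c) || (x \in A)]; split.
- by apply/subsetP => x; rewrite inE => /andP[].
- have edge_c x y : x \in [set x in S | (x == c) || (x \in A)] ->
      y \in [set x in S | (x == c) || (x \in A)] -> e x y -> (x == c) || (y == c).
    rewrite !inE => /andP[xS /orP[-> //|xA]] /andP[yS /orP[->|yA]]; first by rewrite orbT.
    by have [//|xc] := eqVneq x c; have [//|yc] := eqVneq y c; rewrite col // xA yA.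
  move=> p q r t pX qX rX tX pr pt qt pq qr rt.
  have /orP[/eqP E|/eqP E] := edge_c _ _ pX qX pq;
    have /orP[/eqP E'|/eqP E'] := edge_c _ _ rX tX rt.
  + by rewrite E E' eqxx in pr.
  + by rewrite E E' eqxx in pt.
  + by rewrite E E' eI in qr.
  + by rewrite E E' eqxx in qt.
- move=> y z; rewrite !inE => /andP[+ yS] /andP[+ zS]; rewrite yS zS /= !negb_or.
  by move=> /andP[yc yA] /andP[zc zA]; rewrite col // (negPf yA) (negPf zA).
Qed.

Lemma k4_freeP S : ~~ has_clique e 4 S -> forall a b c d,
  a \in S -> b \in S -> c \in S -> d \in S ->
  e a b -> e a c -> e a d -> e b c -> e b d -> e c d -> False.
Proof.
move=> nK a b c d aS bS cS dS ab ac ad bc bd cd; case/negP: nK.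
apply/has_cliqueP; exists [:: a; b; c; d]; split=> //=.
  by rewrite aS bS cS dS.
by rewrite ab ac ad bc bd cd.
Qed.

Section Extend.

Variables (S R : {set T}).
Hypothesis nK4 : ~~ has_clique e 4 S.

Lemma wheel_extend_center u v w A :
  u \in S -> v \in S -> e u v -> R = S :\: [set y in [:: u; v]] ->
  w \in R -> e w u -> e w v ->
  (forall x, x \in R -> x != w -> e x u = ~~ e x v) ->
  (forall x, x \in R -> x != w -> e w x) ->
  (forall x y, x \in R -> y \in R -> x != w -> y != w ->
        e x y = ((x \in A) != (y \in A))) ->
  (2 < #|R| -> exists a b, [/\ a \in R, b \in R, a != w, b != w & (a \in A) && (b \notin A)]) ->
  wheel S.
Proof.
move=> uS vS uv RE wR wu wv xor cadj col both.
have RS x : x \in R -> x \in S by rewrite RE inE => /andP[].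
have opp x y : x \in R -> y \in R -> x != w -> y != w -> (x \in A) != (y \in A) ->
    e x u != e y u.
  move=> xR yR xw yw xyA; apply/negP => /eqP xyu.
  have exy : e x y by rewrite col.
  have [wx wy] : e w x /\ e w y by split; apply: cadj.
  have := xor _ xR xw; have := xor _ yR yw.
  case xu: (e x u) xyu => /esym yu; rewrite yu.
    by move=> _ _; apply: (k4_freeP nK4 (RS _ wR) uS (RS _ xR) (RS _ yR)); adj.
  move=> /esym/negbFE yv /esym/negbFE xv.
  by apply: (k4_freeP nK4 (RS _ wR) vS (RS _ xR) (RS _ yR)); adj.
have key x y : x \in R -> y \in R -> x != w -> y != w ->
    (e x u != e y u) = ((x \in A) != (y \in A)).
  move=> xR yR xw yw; have [xyA|xyA] := eqVneq (x \in A) (y \in A); last exact: opp.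
  have [->|xy] := eqVneq x y; first by rewrite eqxx.
  have [|a [b [aR bR aw bw /andP[aA bA]]]] := both.
    by apply/card_gt2P; exists w, x, y; split; split; adj.
  have [z [zR zw zA]] : exists z, [/\ z \in R, z != w & (x \in A) != (z \in A)].
    by case xA: (x \in A); [exists b; rewrite (negPf bA) | exists a; rewrite aA].
  have := opp _ _ xR zR xw zw zA; rewrite xyA in zA; have := opp _ _ yR zR yw zw zA.
  by case: (e x u); case: (e y u); case: (e z u).
have split3 x : x \in S -> [\/ x = u, x = v | x \in R].
  move=> xS; have [->|xu] := eqVneq x u; first by constructor 1.
  have [->|xv] := eqVneq x v; first by constructor 2.
  by constructor 3; rewrite RE !inE negb_or xu xv.
exists w, [set x | e x u]; split.
- exact: RS.
- by move=> x /split3[->|->|xR] // xw; apply: cadj.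
- move=> x y; rewrite !inE => /split3 xC /split3 yC xw yw.
  case: xC xw => [->|->|xR] xw; case: yC yw => [->|->|yR] yw; rewrite ?eI ?[e v u]eC ?uv //.
  + by rewrite eC; case: (e y u).
  + by rewrite eC (xor y) //; case: (e y v).
  + by case: (e x u).
  + by rewrite (xor x) //; case: (e x v).
  + by rewrite col // key.
- by move=> _; exists v, u; rewrite !inE eI eC uv; split=> //; adj.
Qed.

Lemma wheel_extend_side u v w c A :
  u \in S -> v \in S -> e u v -> R = S :\: [set y in [:: u; v]] ->
  w \in R -> e w u -> e w v ->
  (forall x, x \in R -> x != w -> e x u = ~~ e x v) ->
  c \in R -> w != c -> e c u ->
  (forall x, x \in R -> x != c -> e c x) ->
  (forall x y, x \in R -> y \in R -> x != c -> y != c ->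
        e x y = ((x \in A) != (y \in A))) ->
  (2 < #|R| -> exists a b, [/\ a \in R, b \in R, a != c, b != c & (a \in A) && (b \notin A)]) ->
  wheel S.
Proof.
move=> uS vS uv RE wR wu wv xor cR wc cu cadj col both.
have RS x : x \in R -> x \in S by rewrite RE inE => /andP[].
have Ruv x : x \in R -> x != u /\ x != v.
  by rewrite RE !inE negb_or => /andP[/andP[]].
have cv : e c v = false by have := xor _ cR; rewrite eq_sym wc cu => /(_ isT); case: (e c v).
have cw := cadj _ wR wc.
have oppu x : x \in R -> x != c -> x != w -> (x \in A) != (w \in A) -> e x u = false.
  move=> xR xc xw xA; apply/negP => xu.
  have cx := cadj _ xR xc; have xwe : e x w by rewrite col.
  by apply: (k4_freeP nK4 uS (RS _ wR) (RS _ cR) (RS _ xR)); adj.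
have opp x : x \in R -> x != c -> x != w -> (x \in A) != (w \in A).
  move=> xR xc xw; apply/negP => /eqP xA.
  have [|a [b [aR bR ac bc /andP[aA bA]]]] := both.
    by apply/card_gt2P; exists w, x, c; split; split; adj.
  have [z [zR zc zA]] : exists z, [/\ z \in R, z != c & (z \in A) != (w \in A)].
    by case wA: (w \in A); [exists b; rewrite (negPf bA) | exists a; rewrite aA].
  have zw : z != w by apply: contraNneq zA => ->.
  have zu := oppu _ zR zc zw zA.
  have zv : e z v by have := xor _ zR zw; rewrite zu => /esym/negbFE.
  have zwe : e z w by rewrite col.
  have zx : e z x by rewrite col // xA.
  have cz := cadj _ zR zc; have cx := cadj _ xR xc.
  have [? ?] := Ruv _ cR; have [? ?] := Ruv _ zR; have [? ?] := Ruv _ xR.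
  by apply: (P6 (a := v) (b := u) (c := w) (d := c) (x := z) (y := x)); adj.
have split4 x : x \in S -> x != w ->
    [\/ x = u, x = v, x = c | [/\ x \in R, e x w, e x c, e x u = false & e x v]].
  move=> xS xw; have [->|xu] := eqVneq x u; first by constructor 1.
  have [->|xv] := eqVneq x v; first by constructor 2.
  have [->|xc] := eqVneq x c; first by constructor 3.
  have xR : x \in R by rewrite RE !inE negb_or xu xv.
  constructor 4; have xA := opp _ xR xc xw; have xu0 := oppu _ xR xc xw xA.
  split=> //; first by rewrite col.
    by rewrite eC cadj.
  by have := xor _ xR xw; rewrite xu0 => /esym/negbFE.
exists w, [set x | e x u]; split.
- exact: RS.
- by move=> x xS xw; have [->|->|->|[_ ? _ _ _]] := split4 x xS xw; adj.
- move=> x y; rewrite !inE => xS yS xw yw.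
  have xC := split4 _ xS xw; have yC := split4 _ yS yw.
  case: xC => [->|->|->|[xR xwe xc xu xv]]; case: yC => [->|->|->|[yR ywe yc yu yv]];
    rewrite ?eI ?[e v u]eC ?[e u c]eC ?[e v c]eC ?[e u y]eC ?[e v y]eC ?[e c y]eC
      ?uv ?cu ?cv ?xu ?xv ?xc ?yu ?yv ?yc //.
  have [xc' yc'] : x != c /\ y != c by split; apply: adj_neq.
  have := opp _ xR xc' xw; have := opp _ yR yc' yw; rewrite col //.
  by case: (x \in A); case: (y \in A); case: (w \in A).
- by move=> _; exists v, u; rewrite !inE eI eC uv; split=> //; adj.
Qed.

Lemma wheel_extend u v w :
  u \in S -> v \in S -> e u v -> R = S :\: [set y in [:: u; v]] ->
  w \in R -> e w u -> e w v ->
  (forall x, x \in R -> x != w -> e x u = ~~ e x v) ->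
  wheel R -> wheel S.
Proof.
move=> uS vS uv RE wR wu wv xor [c [A [cR cadj col both]]].
have [cw|cw] := eqVneq c w.
  by rewrite cw in cadj col both; apply: (wheel_extend_center uS vS uv RE wR wu wv xor cadj col both).
have wc : w != c by rewrite eq_sym.
case cu: (e c u).
  exact: (wheel_extend_side uS vS uv RE wR wu wv xor cR wc cu cadj col both).
have cv : e c v by have := xor _ cR cw; rewrite cu => /esym/negbFE.
have vu : e v u by rewrite eC.
have RE' : R = S :\: [set y in [:: v; u]].
  by rewrite RE; apply/setP => y; rewrite !inE orbC.
apply: (wheel_extend_side vS uS vu RE' wR wv wu _ cR wc cv cadj col both).
by move=> x xR xw; rewrite xor // negbK.
Qed.

End Extend.

(* Otherwise each edge of a triangle extends to further triangles, and four consecutive ones form a P^2_6. *)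
Lemma light_edge S : ~~ has_clique e 4 S -> (exists a b, [/\ a \in S, b \in S & e a b]) ->
  exists u v, [/\ u \in S, v \in S, e u v & #|[set x in S | e x u && e x v]| <= 1].
Proof.
move=> nK4 [a [b [aS bS ab]]].
case: (boolP [exists u in S, exists v in S,
    e u v && (#|[set x in S | e x u && e x v]| <= 1)]).
  by move=> /exists_inP[u uS /exists_inP[v vS /andP[uv h]]]; exists u, v.
move=> /exists_inPn h; exfalso.
have common u v w : u \in S -> v \in S -> e u v ->
    exists z, [/\ z \in S, z != w, e z u & e z v].
  move=> uS vS uv; have /exists_inPn/(_ v vS) := h u uS; rewrite uv -ltnNge.
  case/card_gt1P => x [y [+ + xy]]; rewrite !inE => /and3P[xS xu xv] /and3P[yS yu yv].
  have [E|xw] := eqVneq x w; last by exists x.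
  by exists y; rewrite -E eq_sym.
have [c [cS _ ca cb]] := common a b a aS bS ab.
have [d [dS dc da db]] := common a b c aS bS ab.
have cd : e c d = false.
  by apply/negP => cd; apply: (k4_freeP nK4 aS bS cS dS); adj.
have [x [xS xb xa xc]] := common a c b aS cS (etrans (eC a c) ca).
have xbe : e x b = false.
  by apply/negP => xb'; apply: (k4_freeP nK4 aS bS cS xS); adj.
have [y [yS ya yb yd]] := common b d a bS dS (etrans (eC b d) db).
have xd : x != d by apply: contraTneq xc => ->; rewrite eC cd.
have xy : x != y by apply: contraTneq yb => <-; rewrite xbe.
have cy : c != y by apply: contraTneq yd => <-; rewrite cd.
by apply: (P6 (a := x) (b := c) (c := a) (d := b) (x := d) (y := y)); adj.
Qed.

Lemma k4_free_bound S : ~~ has_clique e 4 S -> 0 < #|S| ->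
  2 * arcs S S + 4 + ~~ odd #|S| <= #|S|.+1 ^ 2 /\
  (2 * arcs S S + 4 + ~~ odd #|S| = #|S|.+1 ^ 2 -> wheel S).
Proof.
have [n] := ubnP #|S|; elim: n S => // n IH S Sn nK4 S0.
have bS := arcs_diag_le eI S.
have [S3|S3] := leqP 3 #|S|; last first.
  have [S1|S2] : #|S| = 1 \/ #|S| = 2 by lia.
    rewrite S1 /= in bS *; split; first by lia.
    move=> _; have /eqP/cards1P[c Sc] := S1; exists c, set0; rewrite S1 Sc.
    split=> //; first by rewrite inE.
      by move=> x; rewrite inE => ->.
    by move=> x y; rewrite inE => ->.
  rewrite S2 /= in bS *; split; first by lia.
  move=> eqS; have /eqP/cards2P[c [d [cd Sc]]] := S2.
  have cde : e c d.
    move: eqS; rewrite Sc /arc_count /degree_in !big_setU1 ?inE //= !big_set1 !eI.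
    by rewrite big_setU1 ?inE //= big_set1 !eI [e d c]eC; case: (e c d).
  have dc : d == c = false by rewrite eq_sym (negPf cd).
  exists c, [set d]; rewrite S2; split=> //; first by rewrite Sc !inE eqxx.
    by move=> x; rewrite Sc !inE => /orP[->|/eqP->].
  move=> x y; rewrite Sc !inE => /orP[->|/eqP->] // /orP[->|/eqP->] // _ _.
  by rewrite eI eqxx.
have [[a [b ab]]|noedge] : (exists a b, [/\ a \in S, b \in S & e a b]) \/
    (forall a b, a \in S -> b \in S -> e a b = false).
  case: (boolP [exists a in S, exists b in S, e a b]).
    by move=> /exists_inP[a aS /exists_inP[b bbS ab]]; left; exists a, b.
  move=> /exists_inPn h; right => a b aS bbS; apply/negbTE.
  by have /exists_inPn := h a aS; apply.
2: { have a0 : arcs S S = 0.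
    by apply: big1 => x xS; apply: big1 => y yS; rewrite noedge.
  have : 4 + ~~ odd #|S| < #|S|.+1 ^ 2 by case: (~~ odd _); nia.
  by rewrite a0; split; lia. }
have [u [v [uS vS uv C1]]] : exists u v, _ := light_edge nK4 (ex_intro _ a (ex_intro _ b ab)).
set C := [set x in S | e x u && e x v] in C1.
have us : uniq [:: u; v] by rewrite /= inE (adj_neq eI uv).
have sS : all [in S] [:: u; v] by rewrite /= uS vS.
pose K := [set y in [:: u; v]]; pose R := S :\: K.
have sub : K \subset S by apply/subsetP => t; rewrite inE; move/allP: sS; exact.
have cR : #|R| = #|S| - 2 := card_setD_seq us sS.
have degE x : deg_in x K = e x u + e x v.
  by rewrite deg_in_seq // !big_cons big_nil addn0.
have bK : arcs K K <= 2 by have := arcs_diag_le eI K; rewrite card_set_seq.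
have degR x : x \in R -> deg_in x K <= 1 + (x \in C).
  rewrite degE !inE => /andP[_ ->] /=.
  by case: (e x u); case: (e x v).
have sumR : \sum_(x in R) (1 + (x \in C)) <= #|R| + 1.
  rewrite big_split /= sum1_card leq_add2l sum_pred_card.
  apply: leq_trans C1; apply: subset_leq_card.
  by apply/subsetP => x; rewrite inE => /andP[].
have bRK : arcs R K <= #|R| + 1 by apply: leq_trans sumR; apply: leq_sum.
have nK4R : ~~ has_clique e 4 R.
  apply: contra nK4 => /has_cliqueP[s [ss /allP sR es]]; apply/has_cliqueP.
  by exists s; split=> //; apply/allP => x /sR; rewrite inE => /andP[].
have [||bR eqR] := IH R _ nK4R; [by nlia | by nlia | ].
have eS := arcs_split eC sub; rewrite -/R in eS.
have odR : odd #|R| = odd #|S|.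
  by rewrite cR oddB ?addbF //; nlia.
rewrite odR in bR eqR.
have sq : #|S|.+1 ^ 2 = #|R|.+1 ^ 2 + 4 * #|S|.
  by rewrite cR -{1 3}(subnK (ltnW S3)); clear; nia.
have cSR : #|S| = #|R| + 2 by rewrite cR subnK // ltnW.
split; first by move: (~~ odd _) bR => o bR; nlia.
move: (~~ odd _) bR eqR => o bR eqR eqS.
have wR : wheel R by apply: eqR; nlia.
have fullK : #|R| + 1 <= arcs R K by nlia.
have degEq := sum_eq_bound degR (leq_trans sumR fullK).
have [w wR' wC] : exists2 w, w \in R & w \in C.
  case: (boolP [exists w in R, w \in C]); first by move=> /exists_inP.
  move=> /exists_inPn h; move: fullK; rewrite leqNgt addn1 ltnS.
  rewrite /arc_count (eq_bigr (fun=> 1)) ?sum1_card ?leqnn //.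
  by move=> x xR; rewrite degEq // (negPf (h x xR)).
have /andP[wu wv] : e w u && e w v by move: wC; rewrite inE => /andP[].
apply: (@wheel_extend S R nK4 u v w) => // x xR xw.
have xC : x \in C = false.
  by apply: contraNF xw => xC; apply/eqP; move/card_le1_eqP: C1; apply.
by have := degEq _ xR; rewrite degE xC; case: (e x u); case: (e x v).
Qed.

End K4Free.

Lemma turanD5 m : 0 < m -> 10 + m + turan m < turan (m + 5).
Proof.
have [->|m1 m0] := eqVneq m 1; first by [].
have := turanE (m + 5); have := turanE m.
have := turan_defect_le5 (m + 5); have := turan_defect_le5 m; nia.
Qed.

Section Bound.

Variables (T : finType) (e : rel T).
Hypotheses (eC : symmetric e) (eI : irreflexive e).
Implicit Types (A B K S X : {set T}) (s : seq T).

Notation arcs := (arc_count e).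
Notation deg_in := (degree_in e).

Lemma has_clique_sub k A B : A \subset B -> has_clique e k A -> has_clique e k B.
Proof.
move=> /subsetP AB /has_cliqueP[s [ss /allP sA es]]; apply/has_cliqueP.
by exists s; split=> //; apply/allP => x /sA /AB.
Qed.

Lemma turan_bound S : p6_free e -> (#|S| == 5) && has_clique e 5 S = false ->
  arcs S S <= 2 * turan #|S| /\ (arcs S S = 2 * turan #|S| -> structured e S).
Proof.
move=> P6; have [n] := ubnP #|S|; elim: n S => // n IH S Sn not5.
have [K5|nK5] := boolP (has_clique e 5 S).
  rewrite K5 andbT in not5.
  have [s [ss sS es]] := has_cliqueP _ _ _ K5.
  have us := pairwise_uniq_adj eI es.
  have := k5_removal eC eI P6 ss es sS.
  set R := S :\: _; have cR : #|R| = #|S| - 5 by rewrite (card_setD_seq us sS) ss.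
  have cS : 5 <= #|S|.
    rewrite -ss -(card_set_seq us); apply: subset_leq_card.
    by apply/subsetP => x; rewrite inE; move/allP: sS; exact.
  have m0 : 0 < #|S| - 5 by move/eqP: not5; lia.
  have := turanD5 m0; rewrite subnK //.
  suff bR : arcs R R <= 2 * turan (#|S| - 5) \/ #|S| = 10 /\ arcs R R <= 20.
    move=> lt bS; suff lt' : arcs S S < 2 * turan #|S|.
      by split; [exact: ltnW | move=> eq; rewrite eq ltnn in lt'].
    case: bR => [bR|[S10 bR]]; first by nlia.
    by move: bS; rewrite S10; have -> : turan 10 = 30 by []; nlia.
  have [R5|R5] := eqVneq #|R| 5.
    right; split; first by nlia.
    by have := arcs_diag_le eI R; rewrite R5.
  left; rewrite -cR; apply: (proj1 (IH R _ _)); first by nlia.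
  by rewrite (negPf R5).
have nK5sub X : (#|S :\: X| == 5) && has_clique e 5 (S :\: X) = false.
  apply/negP => /andP[_ /(has_clique_sub (subsetDl S X))]; exact: (negP nK5).
pose block t := [&& all [in S] t, uniq t, pairwise e (take 3 t) &
                    all (fun x => all (e x) (take 3 t)) (drop 3 t)].
have [/existsP[[t /=]]|nW] := boolP [exists t : 6.-tuple T, block t].
  case: t => [|a [|b [|c [|x [|y [|z [|//]]]]]]] // _.
  case/and4P=> tS tu; rewrite /= !andbT.
  move=> /andP[/andP[ab ac] bc] /and3P[/and3P[xa xb xc] /and3P[ya yb yc] /and3P[za zb zc]].
  have IHR := proj1 (IH (S :\: [set t in [:: a; b; c; x; y; z]]) _ (nK5sub _)).
  rewrite (card_setD_seq tu tS) /= in IHR.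
  have cS : 6 <= #|S|.
    rewrite -[6]/(size [:: a; b; c; x; y; z]) -(card_set_seq tu); apply: subset_leq_card.
    by apply/subsetP => t; rewrite inE; move/allP: tS; exact.
  apply: (block_removal eC eI P6 tu) => //; apply: IHR; nlia.
have {}nW a b c x y z : all [in S] [:: a; b; c; x; y; z] ->
  uniq [:: a; b; c; x; y; z] -> pairwise e [:: a; b; c] ->
  all (e x) [:: a; b; c] -> all (e y) [:: a; b; c] -> all (e z) [:: a; b; c] -> False.
  move=> h1 h2 h3 h4 h5 h6; case/negP: nW; apply/existsP.
  exists [tuple a; b; c; x; y; z]; apply/and4P; split=> //.
  by apply/and4P; split.
have [K4|nK4] := boolP (has_clique e 4 S).
  have [s [ss sS es]] := has_cliqueP _ _ _ K4.
  have us := pairwise_uniq_adj eI es.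
  have IHR := proj1 (IH (S :\: [set t in s]) _ (nK5sub _)).
  rewrite (card_setD_seq us sS) ss in IHR.
  have cS : 4 <= #|S|.
    rewrite -ss -(card_set_seq us); apply: subset_leq_card.
    by apply/subsetP => x; rewrite inE; move/allP: sS; exact.
  apply: (k4_removal eC eI P6 sS ss es nK5 nW); apply: IHR; nlia.
have [S0|S0] := posnP #|S|.
  have -> : S = set0 by apply: cards0_eq.
  have -> : arcs set0 set0 = 0 by exact: big_set0.
  by split=> // _; exists set0; split; rewrite ?sub0set // => y; rewrite !inE.
have [bS eqS] := k4_free_bound eC eI P6 nK4 S0.
have tE := turanE #|S|; have dO := turan_defect_odd #|S|.
have oE : ~~ odd #|S| + odd #|S| = 1 :> nat by case: (odd _).
move: (~~ odd _ : nat) (odd _ : nat) oE bS eqS dO => o o' oE bS eqS dO.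
by split=> [|h]; [nlia | apply: (wheel_structured eI); apply: eqS; nlia].
Qed.

(* Adjacency of [F_graph] inside X = {0, ..., i-1}. For [j = 0] there is no star and it is that of [H_graph]. *)
Definition pattern (i j u v : nat) : bool :=
  [&& u < i - j, v < i - j, u != v & u %/ 3 == v %/ 3]
  || ((u == i - j) && (i - j < v < i) || (v == i - j) && (i - j < u < i)).

Definition listed X j : Prop := exists s, [/\ uniq s, s =i X &
  forall x0 a b, a < size s -> b < size s ->
    e (nth x0 s a) (nth x0 s b) = pattern (size s) j a b].

Lemma p4_free_sub A B : A \subset B -> p4_free e B -> p4_free e A.
Proof. by move=> /subsetP AB h p q r t /AB ? /AB ? /AB ? /AB ?; apply: h. Qed.

Lemma triangle_free_p4_free X : p4_free e X ->
  (forall a b c, a \in X -> b \in X -> c \in X -> e a b -> e a c -> e b c -> False) ->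
  X != set0 ->
  (arcs X X + 2 = 2 * #|X| /\
    exists2 c, c \in X & forall x y, x \in X -> y \in X -> e x y = ((x == c) != (y == c)))
  \/ arcs X X + 4 <= 2 * #|X|.
Proof.
have [n] := ubnP #|X|; elim: n X => // n IH X Xn hP4 hT X0.
have [[a [b [aX bX ab]]]|noedge] : (exists a b, [/\ a \in X, b \in X & e a b]) \/
    (forall a b, a \in X -> b \in X -> e a b = false).
  case: (boolP [exists a in X, exists b in X, e a b]).
    by move=> /exists_inP[a aS /exists_inP[b bbS ab]]; left; exists a, b.
  move=> /exists_inPn h; right => a b aS bbS; apply/negbTE.
  by have /exists_inPn := h a aS; apply.
2: { have a0 : arcs X X = 0.
    by apply: big1 => x xS; apply: big1 => y yS; rewrite noedge.
  rewrite a0; have [c cX] := set0Pn _ X0.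
  have [X1|X1] := eqVneq #|X| 1; last first.
    by right; rewrite -card_gt0 in X0; lia.
  left; rewrite X1; split=> //; exists c => // x y xX yX; rewrite noedge //.
  have /eqP/cards1P[d Xd] := X1; move: xX yX cX; rewrite Xd !inE.
  by move=> /eqP-> /eqP-> /eqP->; rewrite eqxx. }
have {a b aX bX ab}[a [b [aX bX ab leaf]]] : exists a b,
    [/\ a \in X, b \in X, e a b & forall x, x \in X -> e x b -> x = a].
  have [[x xX /andP[xa xb]]|ha] := altP (@exists_inP _ [in X] (fun x => e x a && (x != b))).
    exists a, b; split=> // y yX yb; apply/eqP; apply/negPn/negP => ya.
    have [E|xy] := eqVneq x y; first by rewrite -E in yb; apply: (hT a b x); adj.
    by apply: (hP4 x a b y) => //; adj.
  exists b, a; split=> //; first by rewrite eC.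
  move=> y yX ya; have /exists_inPn/(_ y yX) := ha.
  by rewrite ya /= negbK => /eqP.
pose N := [set y in X | e a y]; pose R := X :\: N.
have NX : N \subset X by apply/subsetP => y; rewrite inE => /andP[].
have onlya y z : y \in N -> z \in X -> e y z -> z = a.
  rewrite inE => /andP[yX ay] zX yz; have [E|yb] := eqVneq y b.
    by apply: leaf => //; rewrite eC -E.
  apply/eqP/negPn/negP => za; have [E|zb] := eqVneq z b.
    by case/eqP: (adj_neq eI ay); rewrite [y]leaf // -E.
  by apply: (hP4 b a y z) => //; adj.
have aR : a \in R by rewrite !inE aX eI.
have aN : a \notin N by rewrite !inE eI andbF.
have bNN : arcs N N = 0.
  apply: big1 => y yN; apply: big1 => z zN; case yz: (e y z) => //.
  by move: (zN); rewrite (onlya y z) ?(negPf aN) // (subsetP NX).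
have bNR : arcs R N = #|N|.
  rewrite (arcsC eC) /arc_count -sum1_card; apply: eq_bigr => y yN.
  rewrite /degree_in (bigD1 a) //= big1 ?addn0 => [|z /andP[zR za]].
    by move: yN; rewrite inE eC => /andP[_ ->].
  case yz: (e y z) => //; case/eqP: za; apply: onlya yz => //.
  by move: zR; rewrite inE => /andP[].
have RX : R \subset X by apply: subsetDl.
have cR : #|X| = #|N| + #|R|.
  by rewrite cardsD (setIidPr NX) subnKC // subset_leq_card.
have eX := arcs_split eC NX; rewrite -/R bNN bNR in eX.
have N0 : 0 < #|N| by apply/card_gt0P; exists b; rewrite inE bX.
have [||||[eR [c cRin star]]|h] := IH R; first by nlia.
- exact: p4_free_sub hP4.
- by move=> p q r pR qR rR; apply: hT; apply: (subsetP RX).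
- by apply/set0Pn; exists a.
- left; split; first by nlia.
  have ac : forall x, x \in R -> x = a.
    have aiso x : x \in R -> e a x = false.
      by rewrite !inE => /andP[+ xX]; rewrite xX => /negbTE.
    have ca : c = a.
      apply/eqP/negPn/negP => ca; have := star a c aR cRin.
      by rewrite aiso // eqxx [a == c]eq_sym (negPf ca).
    move=> x xR; apply/eqP/negPn/negP => xa; have := star a x aR xR.
    by rewrite aiso // ca eqxx (negPf xa).
  have XaN x : x \in X -> x = a \/ x \in N.
    by move=> xX; have [xN|xN] := boolP (x \in N); [right | left; apply: ac; rewrite inE xN].
  exists a => // x y xX yX.
  have Na z : z \in N -> z == a = false by move=> zN; apply: contraNF aN => /eqP <-.
  have [->|xN] := XaN x xX; have [->|yN] := XaN y yX; rewrite ?eqxx ?Na ?eI //.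
  + by move: yN; rewrite inE => /andP[].
  + by move: xN; rewrite inE eC => /andP[].
  + by apply/negP => xy; move: (Na y yN); rewrite (onlya x y) ?eqxx.
- by right; nlia.
Qed.

Lemma pattern_shift i j u v : j <= i -> pattern i.+3 j u.+3 v.+3 = pattern i j u v.
Proof.
move=> ji; rewrite /pattern.
have -> : i.+3 - j = (i - j).+3 by lia.
have d3 w : w.+3 %/ 3 = (w %/ 3).+1 by rewrite -addn3 divnDr // addn1.
by rewrite !d3 !eqSS !ltnS.
Qed.

Lemma pattern_sym i j u v : pattern i j u v = pattern i j v u.
Proof.
rewrite /pattern [v == u]eq_sym [v %/ 3 == _]eq_sym; congr (_ || _); last exact: orbC.
by rewrite andbCA.
Qed.

Lemma pattern_lt3 i j u v : j <= i -> u < 3 -> pattern i.+3 j u v.+3 = false.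
Proof.
move=> ji u3; rewrite /pattern.
have -> : i.+3 - j = (i - j).+3 by lia.
have d3 w : w.+3 %/ 3 = (w %/ 3).+1 by rewrite -addn3 divnDr // addn1.
by rewrite d3 divn_small //; lia.
Qed.

Lemma pattern_triangle i j u v : j <= i -> u < 3 -> v < 3 -> pattern i.+3 j u v = (u != v).
Proof.
move=> ji u3 v3; rewrite /pattern.
have -> : i.+3 - j = (i - j).+3 by lia.
by rewrite !divn_small //; lia.
Qed.

Lemma p4_free_decomp X : p4_free e X ->
  (exists j, [/\ j <= #|X|, 3 %| #|X| - j, listed X j &
                 arcs X X + 2 * (0 < j) = 2 * #|X|])
  \/ arcs X X + 4 <= 2 * #|X|.
Proof.
have [n] := ubnP #|X|; elim: n X => // n IH X Xn hP4.
case: (boolP [exists t : 3.-tuple T, all [in X] t && pairwise e t]).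
  case/existsP=> [[t /=]]; case: t => [|a [|b [|c [|//]]]] // _.
  rewrite /= !andbT => /and3P[/and3P[aX bX cX] /andP[ab ac] bc].
  have us : uniq [:: a; b; c] by rewrite /= !inE !negb_or !(adj_neq eI).
  have sX : all [in X] [:: a; b; c] by rewrite /= aX bX cX.
  pose K := [set y in [:: a; b; c]]; pose R := X :\: K.
  have sub : K \subset X by apply/subsetP => t; rewrite inE; move/allP: sX; exact.
  have cR : #|R| = #|X| - 3 := card_setD_seq us sX.
  have c3 : 3 <= #|X| by have := subset_leq_card sub; rewrite card_set_seq.
  have RX : R \subset X by apply: subsetDl.
  have iso x : x \in R -> [/\ e x a = false, e x b = false & e x c = false].
    rewrite !inE !negb_or => /andP[/and3P[? ? ?] xX].
    by split; apply/negP => ?; [apply: (hP4 x a b c) | apply: (hP4 x b a c) |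
                                apply: (hP4 x c a b)] => //; adj.
  have bKK : arcs K K = 6.
    rewrite /arc_count (eq_bigr (fun=> 2)) ?sum_nat_const ?card_set_seq //.
    move=> x; rewrite deg_in_seq // !big_cons big_nil !inE.
    by case/or3P=> /eqP->; rewrite eI ?ab ?ac ?bc ?[e b a]eC ?[e c a]eC ?[e c b]eC ?ab ?ac ?bc.
  have bRK : arcs R K = 0.
    apply: big1 => x xR; rewrite deg_in_seq // !big_cons big_nil.
    by have [-> -> ->] := iso x xR.
  have eX := arcs_split eC sub; rewrite -/R bKK bRK in eX.
  have [||[j [jR dj [s [su sR sE]] eR]]|] := IH R; first by nlia.
  - exact: p4_free_sub hP4.
  - left; exists j; split; [by nlia | | | by nlia].
      by rewrite (_ : #|X| - j = 3 + (#|R| - j)) ?dvdn_addr //; nlia.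
    have ss : size s = #|R| by rewrite -(card_uniqP su); apply: eq_card.
    have sRin z : z \in s -> z \in R by rewrite sR.
    exists [:: a, b, c & s]; split.
    + rewrite -[_ :: _]/([:: a; b; c] ++ s) cat_uniq us su andbT.
      by apply/hasPn => z /sRin; rewrite !inE => /andP[].
    + move=> z; rewrite -[_ :: _]/([:: a; b; c] ++ s) mem_cat sR in_setD !in_set.
      by case zK: (z \in [:: a; b; c]) => //=; move/allP: sX => /(_ _ zK).
    + move=> x0; have js : j <= size s by rewrite ss.
      have iso' k : k < size s -> [/\ e (nth x0 s k) a = false,
          e (nth x0 s k) b = false & e (nth x0 s k) c = false].
        by move=> ks; apply: iso; apply: sRin; apply: mem_nth.
      case=> [|[|[|u]]]; case=> [|[|[|v]]] /=; rewrite ?ltnS => hu hv;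
        try (by rewrite pattern_triangle // ?eI ?[e b a]eC ?[e c a]eC ?[e c b]eC);
        try (by rewrite pattern_lt3 // eC; have [] := iso' v hv);
        try (by rewrite pattern_sym pattern_lt3 //; have [] := iso' u hu).
      by rewrite pattern_shift // sE.
  - by move=> h; right; nlia.
move=> /existsPn noT.
have [->|X0] := eqVneq X set0.
  left; exists 0; rewrite cards0; split=> //; last by rewrite /arc_count big_set0.
  by exists [::]; split=> // x; rewrite inE.
have hT a b c : a \in X -> b \in X -> c \in X -> e a b -> e a c -> e b c -> False.
  move=> aX bX cX ab ac bc; have := noT [tuple a; b; c].
  by rewrite /= aX bX cX ab ac bc.
have [[eX [c cX star]]|] := triangle_free_p4_free hP4 hT X0; last by right.
left; exists #|X|; rewrite subnn dvdn0 leqnn; split=> //; last by rewrite card_gt0 X0 muln1.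
pose s := c :: enum (X :\ c).
have su : uniq s by rewrite /= mem_enum !inE eqxx enum_uniq.
have sX : s =i X.
  by move=> x; rewrite inE mem_enum !inE; case: eqVneq => [->|].
have ss : size s = #|X| by rewrite -(card_uniqP su); apply: eq_card.
exists s; split=> // x0 u v us vs.
have nthc k : k < size s -> (nth x0 s k == c) = (k == 0).
  by move=> ks; rewrite -[c]/(nth x0 s 0) nth_uniq.
rewrite star -?sX ?mem_nth // !nthc // /pattern ss subnn /=.
by move: us vs; rewrite ss; case: u => [|u]; case: v => [|v] //= hu hv; rewrite ?hu ?hv.
Qed.

End Bound.

Lemma simple_graphP (T : finType) (e : rel T) :
  simple_graph e <-> symmetric e /\ irreflexive e.
Proof.
split=> [/andP[/forallP eI /forallP eC]|[eC eI]].
  by split=> [x y|x]; [move/forallP/(_ y)/eqP: (eC x) | apply: negbTE].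
apply/andP; split; apply/forallP => x; first by rewrite eI.
by apply/forallP => y; rewrite eC.
Qed.

Lemma arcs_edges (T : finType) (e : rel T) : symmetric e -> irreflexive e ->
  arc_count e setT setT = 2 * #|edges e|.
Proof.
move=> eC eI.
have -> : arc_count e setT setT = \sum_(p : T * T | e p.1 p.2) 1.
  rewrite big_mkcond /= -(pair_bigA _ (fun x y => if e x y then 1 else 0)) /=.
  rewrite /arc_count; under eq_bigl do rewrite inE; apply: eq_bigr => x _.
  by rewrite /degree_in; under eq_bigl do rewrite inE; apply: eq_bigr => y _; case: (e x y).
rewrite (partition_big (fun p => [set p.1; p.2]) [in edges e]) /=; last first.
  move=> [x y] /= exy; rewrite inE; apply/existsP; exists x; apply/existsP; exists y.
  by rewrite exy eqxx.
rewrite mulnC -sum_nat_const; apply: eq_bigr => A.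
rewrite inE => /existsP[x /existsP[y /andP[exy /eqP->]]].
have xy := adj_neq eI exy.
rewrite sum1_card -(_ : #|[set (x, y); (y, x)]| = 2); last first.
  by rewrite cards2 xpair_eqE negb_and xy.
apply: eq_card => -[u v]; rewrite !inE /= !xpair_eqE.
apply/andP/orP => [[euv /eqP E]|[/andP[/eqP-> /eqP->]|/andP[/eqP-> /eqP->]]].
- have : u \in [set x; y] by rewrite -E !inE eqxx.
  have : v \in [set x; y] by rewrite -E !inE eqxx orbT.
  rewrite !inE => /orP[]/eqP vE /orP[]/eqP uE; move: euv; rewrite uE vE ?eI // !eqxx => _;
    by [left | right].
- by [].
- by rewrite eC setUC.
Qed.

Lemma p6_freeP (T : finType) (e : rel T) : symmetric e ->irreflexive e ->
  ~~ contains (@path_square 6) e <-> p6_free e.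
Proof.
move=> eC eI; split=> [nc a b c d x y ad ax ay bx byy cy ab ac bc bd cd cx dx dy xy|P6].
  case/negP: nc; apply/existsP; pose l := [:: a; b; c; d; x; y].
  have ul : uniq l.
    rewrite /= !inE !negb_or; repeat (apply/andP; split=> //); adj.
  exists [ffun i : 'I_6 => nth a l i]; apply/andP; split.
    apply/injectiveP => i j; rewrite !ffunE => /eqP.
    by rewrite nth_uniq // => /eqP/val_inj.
  apply/forallP => -[u hu]; apply/forallP => -[v hv]; rewrite !ffunE /=; apply/implyP.
  case: u hu => [|[|[|[|[|[|u]]]]]] hu //; case: v hv => [|[|[|[|[|[|v]]]]]] hv //;
    rewrite /path_square //= => _; adj.
apply/existsP => -[f /andP[/injectiveP fI /forallP fe]].
have fn i j : i != j -> f i != f j by apply: contraNneq => /fI->.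
have fa i j : path_square i j -> e (f i) (f j) by move/forallP: (fe i) => /(_ j)/implyP.
apply: (P6 (f (@Ordinal 6 0 isT)) (f (@Ordinal 6 1 isT)) (f (@Ordinal 6 2 isT))
  (f (@Ordinal 6 3 isT)) (f (@Ordinal 6 4 isT)) (f (@Ordinal 6 5 isT)));
  by [apply: fn | apply: fa].
Qed.

Lemma p4_free_p6_free (T : finType) (e : rel T) (X : {set T}) : symmetric e -> irreflexive e ->
  p4_free e X -> (forall x y, x \notin X -> y \notin X -> e x y = false) -> p6_free e.
Proof.
move=> eC eI h4 hY a b c d x y ad ax ay bx byy cy ab ac bc bd cd cx dx dy xy.
have cover u v : e u v -> (u \in X) || (v \in X).
  by apply: contraTT; rewrite negb_or => /andP[uX vX]; rewrite hY.
have np p q r t : p != r -> p != t -> q != t -> e p q -> e q r -> e r t ->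
    [&& p \in X, q \in X, r \in X & t \in X] = false.
  by move=> *; apply/negP => /and4P[*]; apply: (h4 p q r t).
have := cover _ _ ab; have := cover _ _ ac; have := cover _ _ bc.
have := cover _ _ bd; have := cover _ _ cd; have := cover _ _ cx.
have := cover _ _ dx; have := cover _ _ dy; have := cover _ _ xy.
have : [&& b \in X, c \in X, x \in X & y \in X] = false by apply: np; adj.
have : [&& c \in X, b \in X, d \in X & y \in X] = false by apply: np; adj.
have : [&& b \in X, c \in X, d \in X & x \in X] = false by apply: np; adj.
have : [&& a \in X, c \in X, d \in X & y \in X] = false by apply: np; adj.
have : [&& a \in X, c \in X, d \in X & x \in X] = false by apply: np; adj.
have : [&& a \in X, b \in X, d \in X & x \in X] = false by apply: np; adj.
by case: (a \in X); case: (b \in X); case: (c \in X); case: (d \in X);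
  case: (x \in X); case: (y \in X).
Qed.

Section Transfer.

Variables (S T : finType) (e : rel S) (e' : rel T).
Hypothesis iso : isomorphic e e'.

Lemma isomorphic_simple : simple_graph e' -> simple_graph e.
Proof.
have [f _ fe] := iso; move=> /simple_graphP[eC eI]; apply/simple_graphP.
by split=> [x y|x]; rewrite -!fe // eC.
Qed.

Lemma isomorphic_p6_free : p6_free e' -> p6_free e.
Proof.
have [f bf fe] := iso; move=> P6 a b c d x y; rewrite -!fe -!(inj_eq (bij_inj bf)).
exact: P6.
Qed.

Lemma isomorphic_arcs : arc_count e setT setT = arc_count e' setT setT.
Proof.
have [f bf fe] := iso.
rewrite /arc_count [RHS](reindex f); last exact: onW_bij.
apply: eq_big => x; rewrite ?inE // => _.
rewrite /degree_in [RHS](reindex f); last exact: onW_bij.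
by apply: eq_big => y; rewrite ?inE // => _; rewrite fe.
Qed.

Lemma isomorphic_card : #|S| = #|T|.
Proof. by have [f bf _] := iso; apply: bij_eq_card bf. Qed.

End Transfer.

Lemma F_graphE n i j (u v : 'I_n) :
  F_graph i j u v = ((u < i) != (v < i)) || pattern i j u v.
Proof. by []. Qed.

Lemma H_graphE n i (u v : 'I_n) : H_graph i u v = F_graph i 0 u v.
Proof.
have st0 : star i i u v = false by rewrite /star /=; lia.
by rewrite /H_graph /F_graph /= subn0 st0 orbF.
Qed.

Lemma pattern_ge i j u v : j <= i -> i <= v -> pattern i j u v = false.
Proof. by rewrite /pattern; lia. Qed.

Lemma pattern_p4 i j p q r t : p != r -> p != t -> q != t ->
  pattern i j p q -> pattern i j q r -> pattern i j r t -> False.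
Proof. rewrite /pattern; lia. Qed.

Lemma F_graph_sym n i j : symmetric (@F_graph n i j).
Proof. by move=> u v; rewrite !F_graphE pattern_sym eq_sym. Qed.

Lemma F_graph_irr n i j : irreflexive (@F_graph n i j).
Proof. by move=> u; rewrite F_graphE eqxx /pattern eqxx; lia. Qed.

Lemma F_graph_p6_free n i j : j <= i -> p6_free (@F_graph n i j).
Proof.
move=> ji; apply: (@p4_free_p6_free _ _ [set u : 'I_n | u < i]).
- exact: F_graph_sym.
- exact: F_graph_irr.
- move=> p q r t; rewrite !inE !F_graphE => -> -> -> -> /=.
  exact: pattern_p4.
- move=> x y; rewrite !inE -!leqNgt F_graphE => ix iy.
  by rewrite pattern_ge // !ltnNge ix iy.
Qed.

Lemma pattern_count i j : j <= i -> 3 %| i - j ->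
  \sum_(0 <= u < i) \sum_(0 <= v < i) pattern i j u v + 2 * (0 < j) = 2 * i.
Proof.
move=> ji /dvdnP[t tE]; have {ji tE} -> : i = t * 3 + j by lia.
have split3 m (G : nat -> nat) : \sum_(0 <= u < m.+3) G u =
    G 0 + (G 1 + (G 2 + \sum_(0 <= u < m) G u.+3)).
  by rewrite !big_nat_recl.
elim: t => [|t IH].
  rewrite add0n; case: j => [|j]; first by rewrite big_nil.
  have row0 : \sum_(0 <= v < j.+1) pattern j.+1 j.+1 0 v = j.
    rewrite big_nat_recl // (eq_big_nat _ _ (F2 := fun=> 1)).
      by rewrite sum_nat_const_nat /pattern subnn; lia.
    by move=> v vj; rewrite /pattern subnn; lia.
  have rowS u : u < j -> \sum_(0 <= v < j.+1) pattern j.+1 j.+1 u.+1 v = 1.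
    move=> uj; rewrite big_nat_recl // big1_seq => [|v _].
      by rewrite /pattern subnn; lia.
    by rewrite /pattern subnn; lia.
  rewrite big_nat_recl // row0 (eq_big_nat _ _ (F2 := fun=> 1)) => [|u /andP[_ uj]].
    by rewrite sum_nat_const_nat; lia.
  exact: rowS.
rewrite mulSn -addnA addSn addSn addSn add0n; move: (t * 3 + j) (leq_addl (t * 3) j) IH.
move=> i' ji IH; rewrite split3.
have row u : u < 3 -> \sum_(0 <= v < i'.+3) pattern i'.+3 j u v = 2.
  move=> u3; rewrite split3 !pattern_triangle // big1_seq => [|v _].
    by case: u u3 => [|[|[|]]].
  by rewrite pattern_lt3.
rewrite !row // (eq_big_nat _ _ (F2 := fun u => \sum_(0 <= v < i') pattern i' j u v)).
  by lia.
move=> u _; rewrite split3 !(pattern_sym _ _ u.+3) !pattern_lt3 // !add0n.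
by apply: eq_big_nat => v _; rewrite pattern_shift.
Qed.

Lemma F_graph_arcs n i j : i <= n -> j <= i -> 3 %| i - j ->
  arc_count (@F_graph n i j) setT setT + 2 * (0 < j) = 2 * (i * (n.+1 - i)).
Proof.
move=> ni ji dj; pose X := [set u : 'I_n | u < i].
have wid (G : nat -> nat) : \sum_(u in X) G u = \sum_(0 <= u < i) G u.
  rewrite big_mkord (big_ord_widen n G ni).
  by apply: eq_bigl => u; rewrite inE.
have cX : #|X| = i by rewrite -sum1_card (wid (fun=> 1)) sum_nat_const_nat muln1 subn0.
have eX := arcs_split (@F_graph_sym n i j) (subsetT X).
have cY : #|[set: 'I_n] :\: X| = n - i.
  by rewrite cardsD setTI cX cardsT card_ord.
have bXX : arc_count (@F_graph n i j) X X = \sum_(0 <= u < i) \sum_(0 <= v < i) pattern i j u v.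
  rewrite -(wid (fun u => \sum_(0 <= v < i) pattern i j u v)); apply: eq_bigr => u uX.
  rewrite -(wid (pattern i j u)); apply: eq_bigr => v vX.
  by move: uX vX; rewrite F_graphE !inE => -> ->.
have bYX : arc_count (@F_graph n i j) (setT :\: X) X = (n - i) * i.
  rewrite -cY -[X in _ = _ * X]cX -sum_nat_const; apply: eq_bigr => u; rewrite !inE andbT => uX.
  rewrite -sum1_card; apply: eq_bigr => v; rewrite inE => vX.
  by rewrite F_graphE vX (negPf uX).
have bYY : arc_count (@F_graph n i j) (setT :\: X) (setT :\: X) = 0.
  apply: big1 => u; rewrite !inE andbT => uX; apply: big1 => v; rewrite !inE andbT => vX.
  by rewrite F_graphE (negPf uX) (negPf vX) pattern_ge // leqNgt.
rewrite eX bXX bYX bYY; have := pattern_count ji dj.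
rewrite subSn // mulnS [i * _]mulnC; lia.
Qed.

Lemma listed_isomorphic (T : finType) (e : rel T) (X : {set T}) n j :
  symmetric e -> #|T| = n -> j <= #|X| -> listed e X j ->
  (forall x y, x \in X -> y \notin X -> e x y) ->
  (forall x y, x \notin X -> y \notin X -> e x y = false) ->
  isomorphic e (@F_graph n #|X| j).
Proof.
move=> eC Tn jX [s [su sX sE]] full empty; pose l := s ++ enum (~: X).
have ss : size s = #|X| by rewrite -(card_uniqP su); apply: eq_card.
have lP x : x \in l by rewrite mem_cat sX mem_enum inE orbN.
have lu : uniq l.
  rewrite cat_uniq su enum_uniq andbT; apply/hasPn => x.
  by rewrite mem_enum inE /= sX.
have ln : size l = n.
  by rewrite -(card_uniqP lu) -Tn; apply: eq_card => x; rewrite lP.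
have fP x : index x l < n by rewrite -ln index_mem.
have fX x : (index x l < #|X|) = (x \in X).
  rewrite -ss index_cat sX; case: ifP => xX; first by rewrite index_mem sX.
  by apply/negbTE; rewrite -leqNgt leq_addr.
have fE x y : x \in X -> y \in X -> e x y = pattern #|X| j (index x l) (index y l).
  rewrite -!fX -ss => hx hy.
  have := sE x _ _ hx hy.
  have nthl z : index z l < size s -> nth x s (index z l) = z.
    move=> hz; have := nth_index x (lP z).
    by rewrite {1}/l nth_cat hz.
  by rewrite !nthl.
exists (fun x => Ordinal (fP x)).
  apply: inj_card_bij; last by rewrite card_ord Tn.
  move=> x y /(congr1 val) /= xy.
  by rewrite -(nth_index x (lP x)) xy nth_index.
move=> x y; rewrite F_graphE /= !fX.
case xX: (x \in X); case yX: (y \in X) => /=.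
- by rewrite fE.
- by rewrite full // yX.
- by rewrite eC full // xX.
- by rewrite empty ?xX ?yX // pattern_ge // leqNgt fX yX.
Qed.

Lemma mul_sub_bound i N : i <= N -> 4 * (i * (N - i)) <= N ^ 2.
Proof. by move=> /subnKC iN; have [+ _] := nat_AGM2 i (N - i); rewrite iN. Qed.

Lemma mul_sub_inj i a N : i <= N -> a <= N -> i * (N - i) = a * (N - a) ->
  i = a \/ i = N - a.
Proof.
move=> /subnKC; move: (N - i) => i' <-{N} aN E.
have {E} : i * i' = a * (i + i' - a) by [].
have := subnKC aN; move: (i + i' - a) => a' h E.
have [ia|ia] := leqP i a.
  have [d dE] : exists d, a = i + d by exists (a - i); lia.
  have : i' = a' + d by lia.
  move=> i'E; subst; have : d * (a' - i) = 0 /\ d * (i - a') = 0 by nia.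
  by case: d {h E aN ia} => [|d]; lia.
have [d dE] : exists d, i = a + d by exists (i - a); lia.
have : a' = i' + d by lia.
move=> a'E; subst; have : d * (i' - a) = 0 /\ d * (a - i') = 0 by nia.
by case: d {h E aN ia} => [|d]; lia.
Qed.

(* Edge count of [F_graph n i j], with [j = 0] standing for [H_graph n i], is maximal. *)
Definition turan_param n i j :=
  [/\ i <= n, j <= i, 3 %| i - j & turan n + (0 < j) = i * (n.+1 - i)].

Lemma turan_residue k r : r < 6 -> 4 * turan (6 * k + r) + nth 0 [:: 1; 4; 5; 4; 1; 0] r = (6 * k + r).+1 ^ 2.
Proof.
move=> r6; rewrite -turanE; congr (_ + _).
by rewrite /turan_defect mulnC modnMDl modn_small.
Qed.

Lemma turan_ge_mul3 n q : 3 * q <= n -> 3 * q * (n.+1 - 3 * q) <= turan n.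
Proof.
move=> qn; rewrite leqNgt; apply/negP => lt.
have [d dE] : exists d, n.+1 = 3 * q + d by exists (n.+1 - 3 * q); lia.
rewrite dE addKn in lt.
have [k [r [r6 nE]]] : exists k r, r < 6 /\ n = 6 * k + r.
  by exists (n %/ 6), (n %% 6); rewrite ltn_pmod // mulnC -divn_eq.
have := turan_residue k r6; rewrite -nE dE => tE.
have d1 : d <= 3 * q + 1 /\ 3 * q <= d + 1.
  have c5 : nth 0 [:: 1; 4; 5; 4; 1; 0] r <= 5 by case: r r6 {nE tE} => [|[|[|[|[|[|]]]]]].
  move: (nth _ _ _) c5 tE => c c5 tE; split; rewrite leqNgt; apply/negP => gt.
    have [m mE] : exists m, d = 3 * q + 2 + m by exists (d - (3 * q + 2)); lia.
    by move: tE lt; rewrite mE; move: (3 * q) (turan n) => x t; nia.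
  have [m mE] : exists m, 3 * q = d + 2 + m by exists (3 * q - (d + 2)); lia.
  by move: tE lt; rewrite mE; move: (turan n) => t; nia.
have d3 : d = 3 * q \/ d = 3 * q + 1 \/ d + 1 = 3 * q by lia.
have lt4 : 4 * turan n + 4 <= 4 * (3 * q * d) by lia.
case: r r6 nE tE => [|[|[|[|[|[|//]]]]]] _ nE /= tE; case: d3 => [d3|[d3|d3]]; nia.
Qed.

Lemma turan_param_exists n : exists i j, turan_param n i j.
Proof.
have := divn_eq n 6; have := ltn_pmod n (isT : 0 < 6).
rewrite mulnC; move: (n %/ 6) (n %% 6) => k r r6 ->.
have := turan_residue k r6.
case: r r6 => [|[|[|[|[|[|//]]]]]] _ /= tE.
- by exists (3 * k), 0; split; nia.
- by exists (3 * k), 0; split; nia.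
- by exists (3 * k + 1), 1; split; nia.
- by exists (3 * k + 3), 0; split; nia.
- by exists (3 * k + 3), 0; split; nia.
- by exists (3 * k + 3), 0; split; nia.
Qed.

Lemma F_graph_turan n i j : turan_param n i j ->
  arc_count (@F_graph n i j) setT setT = 2 * turan n.
Proof.
by case=> ni ji dj E; have := F_graph_arcs ni ji dj; lia.
Qed.

Lemma p6_free_arcs_le (T : finType) (e : rel T) : symmetric e -> irreflexive e ->
  p6_free e -> 6 <= #|T| ->
  arc_count e setT setT <= 2 * turan #|T| /\
  (arc_count e setT setT = 2 * turan #|T| -> structured e setT).
Proof.
move=> eC eI P6 T6; have := @turan_bound T e eC eI setT P6; rewrite cardsT; apply.
by rewrite gtn_eqF.
Qed.

Lemma ex_path_square6 n : 6 <= n -> ex n (@path_square 6) = turan n.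
Proof.
move=> n6; apply/eqP; rewrite eqn_leq; apply/andP; split.
  apply/bigmax_leqP => g /andP[/simple_graphP[eC eI] /(p6_freeP eC eI) P6].
  have := @p6_free_arcs_le _ _ eC eI P6; rewrite card_ord => /(_ n6)[].
  by rewrite arcs_edges // leq_mul2l.
have [i [j par]] := turan_param_exists n; have [_ ji _ _] := par.
pose g : {ffun 'I_n * 'I_n -> bool} := [ffun p => F_graph i j p.1 p.2].
have iso : isomorphic [rel x y | g (x, y)] (@F_graph n i j).
  by exists id; [exists id | move=> x y; rewrite /= ffunE].
have sg : simple_graph [rel x y | g (x, y)].
  apply: (isomorphic_simple iso); apply/simple_graphP; split.
    exact: F_graph_sym.
  exact: F_graph_irr.
have [eC eI] := (simple_graphP _).1 sg.
have -> : turan n = #|edges [rel x y | g (x, y)]|.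
  apply/eqP; rewrite -(eqn_pmul2l (isT : 0 < 2)) -(arcs_edges eC eI).
  by rewrite (isomorphic_arcs iso) F_graph_turan.
rewrite /ex; apply: (bigmax_sup g) => //; rewrite sg; apply/p6_freeP => //; apply: (isomorphic_p6_free iso).
exact: F_graph_p6_free.
Qed.

Lemma extremal_path_square6 n (T : finType) (e : rel T) : 6 <= n ->
  extremal n (@path_square 6) e <->
  exists i j, turan_param n i j /\ isomorphic e (@F_graph n i j).
Proof.
move=> n6; split; last first.
  move=> [i [j [par iso]]]; have [_ ji _ _] := par.
  have sg : simple_graph e.
    by apply: (isomorphic_simple iso); apply/simple_graphP; split;
      [exact: F_graph_sym | exact: F_graph_irr].
  have [eC eI] := (simple_graphP _).1 sg; split=> //.
  - by rewrite (isomorphic_card iso) card_ord.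
  - by apply/p6_freeP => //; apply: (isomorphic_p6_free iso); apply: F_graph_p6_free.
  - apply/eqP; rewrite -(eqn_pmul2l (isT : 0 < 2)) -(arcs_edges eC eI) ex_path_square6 //.
    by rewrite (isomorphic_arcs iso) F_graph_turan.
rewrite /extremal ex_path_square6 // => -[Tn /simple_graphP[eC eI]].
move=> /(p6_freeP eC eI) P6 eE.
have aE : arc_count e setT setT = 2 * turan #|T| by rewrite (arcs_edges eC eI) eE Tn.
have T6 : 6 <= #|T| by rewrite Tn.
have [_ /(_ aE) [X [XT hP4 hY]]] := p6_free_arcs_le eC eI P6 T6.
have {}hY x y : x \notin X -> y \notin X -> e x y = false.
  by move=> xX yX; apply: hY; rewrite !inE ?xX ?yX.
have sp := arcs_split eC XT; rewrite aE Tn in sp.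
have aYY : arc_count e (setT :\: X) (setT :\: X) = 0.
  by apply: big1 => x; rewrite !inE andbT => xX; apply: big1 => y;
    rewrite !inE andbT => yX; rewrite hY.
have cY : #|setT :\: X| = n - #|X| by rewrite cardsD setTI cardsT Tn.
have Xn : #|X| <= n by rewrite -Tn max_card.
have aYX := arcs_le e (setT :\: X) X; rewrite cY in aYX.
have tE := turanE n; have t5 := turan_defect_le5 n.
have Xb := mul_sub_bound (leqW Xn).
have XE : #|X| * (n.+1 - #|X|) = (n - #|X|) * #|X| + #|X|.
  by rewrite subSn // mulnS mulnC addnC.
have [[j [jX dj lj aXX]]|aXX] := p4_free_decomp eC eI hP4; last by exfalso; nlia.
have aYXE : arc_count e (setT :\: X) X = (n - #|X|) * #|X|.
  apply/eqP; rewrite eqn_leq aYX /= leqNgt; apply/negP => lt.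
  case: (posnP j) => [j0|j0]; last by exfalso; rewrite j0 in aXX; nlia.
  have [q qE] : exists q, #|X| = 3 * q.
    by move: dj; rewrite j0 subn0 => /dvdnP[q ->]; exists q; rewrite mulnC.
  have := @turan_ge_mul3 n q; rewrite -qE Xn => /(_ isT).
  by rewrite j0 in aXX; nlia.
exists #|X|, j; split; first by split=> //; nlia.
apply: listed_isomorphic => // x y xX yX.
have full : forall z, z \in setT :\: X -> degree_in e z X = #|X|.
  apply: (@sum_eq_bound _ _ _ (fun=> #|X|)); first by move=> z _; apply: deg_in_le.
  by rewrite sum_nat_const cY -aYXE.
have /full dy : y \in setT :\: X by rewrite !inE yX.
have : forall z, z \in X -> (e y z : nat) = 1.
  apply: (@sum_eq_bound _ _ _ (fun=> 1)); first by move=> z _; case: (e y z).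
  by rewrite sum1_card -dy.
by move=> /(_ x xX); rewrite [e y x]eC; case: (e x y).
Qed.

Lemma is_H_F_graph n i (T : finType) (e : rel T) :
  is_H n i e <-> isomorphic e (@F_graph n i 0).
Proof. by split=> -[f bf fe]; exists f => // x y; rewrite -fe H_graphE. Qed.

Lemma turan_param0P (k r i : nat) : r < 6 ->
  turan_param (6 * k + r) i 0 <->
  match r with 0 | 1 => i = 3 * k | 2 => False | _ => i = 3 * k + 3 end.
Proof.
move=> r6; have := turan_residue k r6; rewrite /turan_param subn0.
move: (turan _) => t tE; split=> [[ni _ /dvdnP[q qE] E]|].
  have inj a := @mul_sub_inj i a _ (leqW ni).
  case: r r6 tE ni E inj => [|[|[|[|[|[|//]]]]]] _ /= tE ni E inj.
  - have := inj (3 * k); nia.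
  - have := inj (3 * k); nia.
  - nia.
  - have := inj (3 * k + 1); nia.
  - have := inj (3 * k + 2); nia.
  - have := inj (3 * k + 3); nia.
by case: r r6 tE => [|[|[|[|[|[|//]]]]]] _ //= tE ->; split; nia.
Qed.

Lemma turan_paramSP (k r i j : nat) : r < 6 -> 0 < j ->
  turan_param (6 * k + r) i j <->
  [/\ j <= i, 3 %| i - j &
    match r with
    | 1 => i = 3 * k + 1
    | 2 => i = 3 * k + 1 \/ i = 3 * k + 2
    | 3 => i = 3 * k + 2
    | _ => False
    end].
Proof.
move=> r6 j0; have := turan_residue k r6; rewrite /turan_param j0.
move: (turan _) => t tE; split=> [[ni ji dj E]|[ji dj]].
  have b := mul_sub_bound (leqW ni).
  have inj a := @mul_sub_inj i a _ (leqW ni).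
  split=> //; clear dj; case: r r6 tE ni E b inj => [|[|[|[|[|[|//]]]]]] _ /= tE ni E b inj.
  - nia.
  - have := inj (3 * k + 1); nia.
  - have := inj (3 * k + 1); nia.
  - have := inj (3 * k + 2); nia.
  - nia.
  - nia.
case: r r6 tE => [|[|[|[|[|[|//]]]]]] _ //= tE h; split=> //; try nia;
  case: h => ->; nia.
Qed.

Lemma extremal_residue n k r (T : finType) (e : rel T) : r < 6 -> n = 6 * k + r -> 6 <= n ->
  extremal n (@path_square 6) e <->
  match r with
  | 0 => is_H n (3 * k) e
  | 1 => is_F n (3 * k + 1) e \/ is_H n (3 * k) e
  | 2 => is_F n (3 * k + 1) e \/ is_F n (3 * k + 2) e
  | 3 => is_F n (3 * k + 2) e \/ is_H n (3 * k + 3) e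
  | _ => is_H n (3 * k + 3) e
  end.
Proof.
move=> r6 nE n6; apply: (iff_trans (extremal_path_square6 e n6)); split.
  move=> [i [j []]]; rewrite {1}nE; case: (posnP j) => [->|j0].
    move=> /(turan_param0P k i r6) + /is_H_F_graph.
    by case: r r6 {nE} => [|[|[|[|[|[|//]]]]]] _ // ->; auto.
  move=> /(turan_paramSP k i r6 j0)[ji dj] + iso.
  have : is_F n i e by exists j; rewrite ?j0 ?ji.
  by case: r r6 {nE} => [|[|[|[|[|[|//]]]]]] _ // + h; [move: h => -> | case: h => -> | move: h => ->]; auto.
have useH i : turan_param n i 0 -> is_H n i e ->
    exists i j, turan_param n i j /\ isomorphic e (@F_graph n i j).
  by move=> par /is_H_F_graph iso; exists i, 0.
have useF i : (forall j, 0 < j -> j <= i -> 3 %| i - j -> turan_param n i j) ->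
    is_F n i e -> exists i j, turan_param n i j /\ isomorphic e (@F_graph n i j).
  by move=> par [j /and3P[j0 ji dj] iso]; exists i, j; split=> //; apply: par.
have parH i := (turan_param0P k i r6).2.
have parF i j j0 := (@turan_paramSP k r i j r6 j0).2.
rewrite -nE in parH parF; case: r r6 {nE} parH parF => [|[|[|[|[|[|//]]]]]] _ parH parF.
- by apply: useH; apply: parH.
- by case; [apply: useF => j *; apply: parF | apply: useH; apply: parH].
- by case; apply: useF => j *; apply: parF => //; split=> //; auto.
- by case; [apply: useF => j *; apply: parF | apply: useH; apply: parH].
- by apply: useH; apply: parH.
- by apply: useH; apply: parH.
Qed.

Theorem theorem8 (n : nat) (hn : 6 <= n) (T : finType) (e : rel T) :
  [/\ n = 0 %[mod 6] ->
        (extremal n (@path_square 6) e <-> is_H n n./2 e),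
      n = 1 %[mod 6] ->
        (extremal n (@path_square 6) e <->
           is_F n (uphalf n) e \/ is_H n n./2 e),
      n = 2 %[mod 6] ->
        (extremal n (@path_square 6) e <->
           is_F n n./2 e \/ is_F n (n./2 + 1) e) &
      [/\ n = 3 %[mod 6] ->
            (extremal n (@path_square 6) e <->
               is_F n (uphalf n) e \/ is_H n (uphalf n + 1) e),
          n = 4 %[mod 6] ->
            (extremal n (@path_square 6) e <-> is_H n (n./2 + 1) e) &
          n = 5 %[mod 6] ->
            (extremal n (@path_square 6) e <-> is_H n (uphalf n) e)]].
Proof.
have nE r : n = r %[mod 6] -> r < 6 -> n = 6 * (n %/ 6) + r.
  by move=> + r6; rewrite (modn_small r6) => <-; rewrite mulnC -divn_eq.
split; last split; move=> /nE /(_ isT) {}nE; have := extremal_residue e _ nE hn => /(_ isT);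
  move: (n %/ 6) nE => k nE.
- by have <- : n./2 = 3 * k by lia.
- have <- : n./2 = 3 * k by lia.
  by have <- : uphalf n = n./2 + 1 by lia.
- have <- : n./2 = 3 * k + 1 by lia.
  by have -> : 3 * k + 2 = n./2 + 1 by lia.
- have <- : uphalf n = 3 * k + 2 by lia.
  by have -> : 3 * k + 3 = uphalf n + 1 by lia.
- by have <- : n./2 + 1 = 3 * k + 3 by lia.
- by have <- : uphalf n = 3 * k + 3 by lia.
Qed.
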